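(* Let $K$ be a field, let $\phi$ be a cover of curves over $K$, and assume that the monodromy group $\mathrm{Mon}(\phi)$ has a transitive Dedekind subgroup. Let $\phi=\phi_n\circ\phi_{n-1}\circ\dots\circ\phi_1$ be a decomposition of $\phi$, and for each $i=1,2,\dots,n$ write $\psi_i:=\phi_i\circ\phi_{i-1}\circ\dots\circ\phi_1$. Then for $1\le i<n$ the group $\mathrm{Aut}(\psi_i)$ is a normal subgroup of $\mathrm{Aut}(\psi_{i+1})$, and the quotient group $\mathrm{Aut}(\psi_{i+1})/\mathrm{Aut}(\psi_i)$ is isomorphic to a subgroup of $\mathrm{Aut}(\phi_{i+1})$. In particular, $$\lvert\mathrm{Aut}(\phi)\rvert \ \text{ divides }\ \prod_{i=1}^n\lvert\mathrm{Aut}(\phi_i)\rvert.$$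
   Context: A curve over a field $K$ is a nonsingular, projective, geometrically irreducible one-dimensional variety defined over $K$. A cover of curves over $K$ is a nonconstant separable morphism, defined over $K$, between curves over $K$. A decomposition of a cover $\phi\colon C\to D$ is an expression $\phi=\phi_n\circ\dots\circ\phi_1$ where each $\phi_i\colon C_{i-1}\to C_i$ is a cover of curves over $K$ of degree at least $2$ (with $C_0=C$, $C_n=D$). The monodromy group $\mathrm{Mon}(\phi)$ of a cover $\phi\colon C\to D$ is the Galois group of the Galois closure of the function field extension $K(C)/K(D)$, viewed as a (transitive) group of permutations of the set of $\deg\phi$ embeddings of $K(C)$ into a fixed algebraic closure of $K(D)$ that restrict to the identity on $K(D)$; a subgroup is transitive if it acts transitively on this set. $\mathrm{Aut}(\phi)$ is the group (under composition) of automorphisms $\mu$ of the curve $C$ defined over $K$ with $\phi\circ\mu=\phi$. A Dedekind group is a group all of whose subgroups are normal. *)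

(* Defs.v *)
From HB Require Import structures.
From mathcomp Require Import all_boot all_order all_algebra.
From mathcomp Require Import separable finmap mpoly.
From mathcomp Require Import boolp classical_sets functions cardinality.

Set Implicit Arguments.
Unset Strict Implicit.
Unset Printing Implicit Defensive.

Import GRing.Theory.
Local Open Scope classical_set_scope.
Local Open Scope ring_scope.

(* Projective varieties over K, as integral closed subschemes of P^n_K. *)

Section Varieties.
Variable K : fieldType.

Record homog_prime n (I : set {mpoly K[n]}) : Prop := HomogPrime {
  homog_prime0 : I 0;
  homog_primeD : forall f g, I f -> I g -> I (f + g);
  homog_primeM : forall f g, I g -> I (f * g);
  homog_primeP : forall f g, I (f * g) -> I f \/ I g;
  homog_primeH : forall f d, I f -> I (pihomog mdeg d f);
  (* excludes the unit ideal and the irrelevant ideal *)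
  homog_primeX : exists i, ~ I 'X_i }.

(* The function field of the variety V(I) is determined up to unique          *)
(* isomorphism by the vanishing and generation conditions: vcoord is the      *)
(* generic point of V(I), in homogeneous coordinates, and funfield consists   *)
(* of the quotients G / H of forms of equal degree, with H outside of I,      *)
(* evaluated at the generic point.                                            *)
Record projvar := ProjVar {
  vdim : nat;
  videal : set {mpoly K[vdim.+1]};
  videal_prime : homog_prime videal;
  funfield : fieldType;
  vconst : {rmorphism K -> funfield};
  vcoord : 'I_vdim.+1 -> funfield;
  vanishP : forall d f, f \is d.-homog ->
    (videal f <-> mmap vconst vcoord f = 0);
  funfieldP : forall a, exists d G H,
    [/\ G \is d.-homog, H \is d.-homog, ~ videal H &
        a = mmap vconst vcoord G / mmap vconst vcoord H] }.

Arguments videal : clear implicits.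
Arguments vconst : clear implicits.
Arguments vcoord : clear implicits.

(* Scheme-theoretic points: the closed points and the generic point. *)
Record point (X : projvar) := Point {
  pideal :> set {mpoly K[(vdim X).+1]};
  pideal_prime : homog_prime pideal;
  pideal_sub : videal X `<=` pideal }.

Definition generic (X : projvar) (P : point X) : Prop :=
  pideal P = videal X.

Definition zariski_closed (X : projvar) (Z : set (point X)) : Prop :=
  exists S : set {mpoly K[(vdim X).+1]}, Z = [set P : point X | S `<=` P].

Definition local_ring (X : projvar) (P : point X) : set (funfield X) :=
  [set a | exists d G H,
    [/\ G \is d.-homog, H \is d.-homog, ~ pideal P H &
      a = mmap (vconst X) (vcoord X) G / mmap (vconst X) (vcoord X) H]].

Definition local_max (X : projvar) (P : point X) : set (funfield X) :=
  [set a | exists d G H,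
    [/\ G \is d.-homog, H \is d.-homog, pideal P G, ~ pideal P H &
      a = mmap (vconst X) (vcoord X) G / mmap (vconst X) (vcoord X) H]].

(* Transcendence degree one: some t is transcendental over K, and every       *)
(* element is algebraic over K(t).                                            *)
Definition one_dimensional (X : projvar) : Prop :=
  exists t : funfield X,
    (forall p : {poly K}, (map_poly (vconst X) p).[t] = 0 -> p = 0) /\
    (forall a : funfield X, exists2 p : {poly {poly K}}, p != 0 &
       (map_poly (fun q => (map_poly (vconst X) q).[t]) p).[a] = 0).

Definition extended_ideal n (I : set {mpoly K[n]}) (L : fieldType)
    (sigma : {rmorphism K -> L}) : set {mpoly L[n]} :=
  [set f | exists s : seq ({mpoly L[n]} * {mpoly K[n]}),
     (forall u, u \in s -> I u.2) /\
     f = \sum_(u <- s) u.1 * map_mpoly sigma u.2].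

Definition radical n (L : fieldType) (J : set {mpoly L[n]}) :
    set {mpoly L[n]} :=
  [set f | exists k, J (f ^+ k)].

(* A closed subscheme of projective space is irreducible when the radical of  *)
(* its ideal is prime.                                                        *)
Definition geometrically_irreducible (X : projvar) : Prop :=
  forall (L : fieldType) (sigma : {rmorphism K -> L}) (f g : {mpoly L[_]}),
    let J := radical (extended_ideal (videal X) sigma) in
    J (f * g) -> J f \/ J g.

(* Ideals of a subring O of a field F. *)
Definition subring_ideal (F : fieldType) (O J : set F) : Prop :=
  [/\ J `<=` O, J 0, forall a b, J a -> J b -> J (a + b) &
      forall a b, O a -> J b -> J (a * b)].

Definition noetherian (F : fieldType) (O : set F) : Prop :=
  forall J : set F, subring_ideal O J ->
  exists s : seq F, (forall b, b \in s -> J b) /\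
    (forall a, J a -> exists c : 'I_(size s) -> F,
       (forall i, O (c i)) /\ a = \sum_(i < size s) c i * s`_i).

(* A local ring of dimension 1 is regular if it is noetherian and its maximal *)
(* ideal is generated by one element.                                         *)
Definition regular_local1 (F : fieldType) (O m : set F) : Prop :=
  noetherian O /\
  exists2 t, m t & forall a, m a -> exists2 c, O c & a = c * t.

(* On a one-dimensional variety all points but the generic one, whose local   *)
(* ring is the function field, have a local ring of dimension 1.              *)
Definition nonsingular (X : projvar) : Prop :=
  forall P : point X, ~ generic P ->
    regular_local1 (local_ring P) (local_max P).

Record curve := Curve {
  cvar :> projvar;
  curve_dim1 : one_dimensional cvar;
  curve_nonsingular : nonsingular cvar;
  curve_irr : geometrically_irreducible cvar }.

(* A nonconstant morphism C -> D of curves over K. As a nonconstant morphism  *)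
(* of curves is dominant, it maps the generic point to the generic point, and *)
(* it amounts to a continuous map on points together with an embedding of     *)
(* function fields over K (the map on generic stalks) that restricts to a     *)
(* local homomorphism on each stalk; the structure sheaf is                   *)
(* U |-> \bigcap_(P in U) local_ring P.                                       *)
Record mor (C D : curve) := Mor {
  mpt : point C -> point D;
  mcom : {rmorphism funfield D -> funfield C};
  mcom_const : forall c, mcom (vconst D c) = vconst C c;
  mpt_continuous : forall Z, zariski_closed Z -> zariski_closed (mpt @^-1` Z);
  mcom_stalk : forall P a, local_ring (mpt P) a -> local_ring P (mcom a);
  mcom_local : forall P a, local_max (mpt P) a -> local_max P (mcom a) }.

End Varieties.

Lemma rmorph_ext (R S : nzRingType) (f g : {rmorphism R -> S}) :
  f =1 g -> f = g.
Proof.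
move: f g => [f [[mf] [af]]] [g [[mg] [ag]]] /= /funext e.
by move: mf af mg ag; rewrite e => mf af mg ag;
   rewrite (Prop_irrelevance mf mg) (Prop_irrelevance af ag).
Qed.

Section Morphisms.
Variable K : fieldType.
Implicit Types C D E : curve K.

Lemma mor_ext C D (f g : mor C D) :
  mpt f =1 mpt g -> mcom f =1 mcom g -> f = g.
Proof.
move: f g => [f1 f2 f3 f4 f5 f6] [g1 g2 g3 g4 g5 g6] /= /funext e1.
move=> /rmorph_ext e2; subst g1 g2.
by rewrite (Prop_irrelevance f3 g3) (Prop_irrelevance f4 g4)
           (Prop_irrelevance f5 g5) (Prop_irrelevance f6 g6).
Qed.

Definition mor_id C : mor C C :=
  @Mor K C C id idfun (fun=> erefl) (fun=> id) (fun _ _ => id) (fun _ _ => id).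

Section Comp.
Variables (C D E : curve K) (g : mor D E) (f : mor C D).

Fact comp_const c : mcom f (mcom g (vconst E c)) = vconst C c.
Proof. by rewrite !mcom_const. Qed.

Fact comp_continuous Z :
  zariski_closed Z -> zariski_closed ((mpt g \o mpt f) @^-1` Z).
Proof. by move=> /(mpt_continuous g) /(mpt_continuous f). Qed.

Fact comp_stalk P a :
  local_ring (mpt g (mpt f P)) a -> local_ring P (mcom f (mcom g a)).
Proof. by move=> /mcom_stalk /mcom_stalk. Qed.

Fact comp_local P a :
  local_max (mpt g (mpt f P)) a -> local_max P (mcom f (mcom g a)).
Proof. by move=> /mcom_local /mcom_local. Qed.

Definition mor_comp : mor C E :=
  @Mor K C E (mpt g \o mpt f) (mcom f \o mcom g)
    comp_const comp_continuous comp_stalk comp_local.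
End Comp.

Lemma mor_compA C D E B (h : mor E B) (g : mor D E) (f : mor C D) :
  mor_comp h (mor_comp g f) = mor_comp (mor_comp h g) f.
Proof. exact: mor_ext. Qed.

Lemma mor_comp1 C D (f : mor C D) : mor_comp f (mor_id C) = f.
Proof. exact: mor_ext. Qed.

Lemma mor_1comp C D (f : mor C D) : mor_comp (mor_id D) f = f.
Proof. exact: mor_ext. Qed.

Record aut C := MkAut {
  amor :> mor C C;
  ainv : mor C C;
  ainvK : mor_comp ainv amor = mor_id C;
  amorK : mor_comp amor ainv = mor_id C }.

Lemma aut_ext C (f g : aut C) : amor f = amor g -> f = g.
Proof.
move: f g => [f f' fK f'K] [g g' gK g'K] /= e; subst g.
have e : f' = g'.
  by rewrite -[f']mor_comp1 -g'K mor_compA fK mor_1comp.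
subst g'.
by rewrite (Prop_irrelevance fK gK) (Prop_irrelevance f'K g'K).
Qed.

HB.instance Definition _ C := gen_eqMixin (aut C).
HB.instance Definition _ C := gen_choiceMixin (aut C).

Definition aut_id C : aut C :=
  MkAut (mor_comp1 (mor_id C)) (mor_comp1 (mor_id C)).

Definition aut_inv C (f : aut C) : aut C := MkAut (amorK f) (ainvK f).

Fact aut_compVK C (f g : aut C) :
  mor_comp (mor_comp (ainv g) (ainv f)) (mor_comp f g) = mor_id C.
Proof.
by rewrite -mor_compA (mor_compA (ainv f)) ainvK mor_1comp ainvK.
Qed.

Fact aut_compKV C (f g : aut C) :
  mor_comp (mor_comp f g) (mor_comp (ainv g) (ainv f)) = mor_id C.
Proof.
by rewrite -mor_compA (mor_compA (amor g)) amorK mor_1comp amorK.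
Qed.

Definition aut_comp C (f g : aut C) : aut C :=
  MkAut (aut_compVK f g) (aut_compKV f g).

Fact aut_compA C : associative (@aut_comp C).
Proof. by move=> f g h; apply: aut_ext; exact: mor_compA. Qed.
Fact aut_1comp C : left_id (aut_id C) (@aut_comp C).
Proof. by move=> f; apply: aut_ext; exact: mor_1comp. Qed.
Fact aut_comp1 C : right_id (aut_id C) (@aut_comp C).
Proof. by move=> f; apply: aut_ext; exact: mor_comp1. Qed.
Fact aut_compV C : left_inverse (aut_id C) (@aut_inv C) (@aut_comp C).
Proof. by move=> f; apply: aut_ext; exact: ainvK. Qed.
Fact aut_compVr C : right_inverse (aut_id C) (@aut_inv C) (@aut_comp C).
Proof. by move=> f; apply: aut_ext; exact: amorK. Qed.

HB.instance Definition _ C := isGroup.Build (aut C)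
  (@aut_compA C) (@aut_1comp C) (@aut_comp1 C) (@aut_compV C) (@aut_compVr C).

Definition Aut C D (phi : mor C D) : set (aut C) :=
  [set mu | mor_comp phi mu = phi].

Fixpoint psi (C : nat -> curve K) (phi_ : forall i, mor (C i) (C i.+1))
    (i : nat) : mor (C 0%N) (C i) :=
  if i is i'.+1 then mor_comp (phi_ i') (psi phi_ i') else mor_id (C 0%N).

End Morphisms.

(* Field extensions are given by an embedding iota : E -> F. *)
Definition separable_ext (E F : fieldType) (iota : {rmorphism E -> F}) : Prop :=
  forall a : F, exists2 p : {poly E}, separable_poly p & root (map_poly iota p) a.

Definition ext_degree (E F : fieldType) (iota : {rmorphism E -> F}) (d : nat) :
    Prop :=
  exists b : 'I_d -> F, forall a : F,
    exists! c : {ffun 'I_d -> E}, a = \sum_i iota (c i) * b i.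

Definition is_cover (K : fieldType) (C D : curve K) (phi : mor C D) : Prop :=
  separable_ext (mcom phi).

(* phi = phi_n o ... o phi_1, where the i-th morphism C_(i-1) -> C_i of the   *)
(* decomposition is phi_ i.-1. The curves C i for i > n and the morphisms     *)
(* phi_ i for i >= n play no role.                                            *)
Definition is_decomposition (K : fieldType) (n : nat) (C : nat -> curve K)
    (phi_ : forall i, mor (C i) (C i.+1)) (phi : mor (C 0%N) (C n)) : Prop :=
  [/\ (0 < n)%N,
      forall i, (i < n)%N -> is_cover (phi_ i) /\
        exists2 d, (2 <= d)%N & ext_degree (mcom (phi_ i)) d &
      phi = psi phi_ n].

(* Groups need not be finite; their subgroups are classical sets. *)
Section Groups.
Variable gT : groupType.
Local Open Scope group_scope.
Implicit Types A B G H U V : set gT.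

Definition subgroup H : Prop :=
  [/\ H 1, forall x y, H x -> H y -> H (x * y) & forall x, H x -> H x^-1].

Definition normal_subgroup B A : Prop :=
  [/\ subgroup B, B `<=` A & forall a b, A a -> B b -> B (b ^ a)].

Definition dedekind G : Prop :=
  subgroup G /\ forall H, subgroup H -> H `<=` G -> normal_subgroup H G.

Definition set_mul U V : set gT := [set u * v | u in U & v in V].

(* The set of cosets of B in A; if B is normal in A, it is a group under      *)
(* set_mul.                                                                   *)
Definition quotient A B : set (set gT) := [set set_mul [set a] B | a in A].
End Groups.

Definition quotient_iso_subgroup (gT rT : groupType) (A B : set gT)
    (D : set rT) : Prop :=
  exists (H : set rT) (f : set gT -> rT),
    [/\ subgroup H, H `<=` D, set_bij (quotient A B) H f &
        forall U V, quotient A B U -> quotient A B V ->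
          f (set_mul U V) = (f U * f V)%g].

Section Permutations.
Variable T : Type.

(* {perm T} without the assumption that T is a finType *)
Record permutation := Permutation {
  pfun :> T -> T;
  pinv : T -> T;
  pfunK : cancel pfun pinv;
  pinvK : cancel pinv pfun }.

Lemma permutation_ext (s t : permutation) : s =1 t -> s = t.
Proof.
move: s t => [s s' sK s'K] [t t' tK t'K] /= /funext e; subst t.
have e : s' = t' by apply/funext => x; rewrite -{1}[x]t'K sK.
subst t'.
by rewrite (Prop_irrelevance sK tK) (Prop_irrelevance s'K t'K).
Qed.

HB.instance Definition _ := gen_eqMixin permutation.
HB.instance Definition _ := gen_choiceMixin permutation.

Definition perm_id := @Permutation id id (fun=> erefl) (fun=> erefl).
Definition perm_inv (s : permutation) := Permutation (pinvK s) (pfunK s).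
Definition perm_comp (s t : permutation) :=
  Permutation (can_comp (pfunK s) (pfunK t)) (can_comp (pinvK t) (pinvK s)).

Fact perm_compA : associative perm_comp.
Proof. by move=> s t u; exact: permutation_ext. Qed.
Fact perm_1comp : left_id perm_id perm_comp.
Proof. by move=> s; exact: permutation_ext. Qed.
Fact perm_comp1 : right_id perm_id perm_comp.
Proof. by move=> s; exact: permutation_ext. Qed.
Fact perm_compV : left_inverse perm_id perm_inv perm_comp.
Proof. by move=> s; apply: permutation_ext => x; exact: pfunK. Qed.
Fact perm_compVr : right_inverse perm_id perm_inv perm_comp.
Proof. by move=> s; apply: permutation_ext => x; exact: pinvK. Qed.

HB.instance Definition _ := isGroup.Build permutation
  perm_compA perm_1comp perm_comp1 perm_compV perm_compVr.

Definition transitive_perm (G : set permutation) : Prop :=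
  forall x y : T, exists2 s, G s & s x = y.
End Permutations.

Definition is_algebraic_closure (E : fieldType) (Omega : closedFieldType)
    (j : {rmorphism E -> Omega}) : Prop :=
  forall z : Omega, algebraicOver j z.

Definition is_subfield (F : fieldType) (S : set F) : Prop :=
  [/\ S 1, forall x y, S x -> S y -> S (x - y) &
      forall x y, S x -> S y -> S (x / y)].

Section Monodromy.
Variables (K : fieldType) (C D : curve K) (phi : mor C D).
Variables (Omega : closedFieldType) (j : {rmorphism funfield D -> Omega}).

Definition embedding :=
  {e : {rmorphism funfield C -> Omega} | forall a, e (mcom phi a) = j a}.

(* The compositum in Omega of all the conjugates of K(C) over K(D). *)
Definition galois_closure : set Omega :=
  [set z | forall S : set Omega, is_subfield S -> range j `<=` S ->
     (forall (e : embedding) a, S (sval e a)) -> S z].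

(* The values of sigma outside of the Galois closure are irrelevant. *)
Definition galois_aut (sigma : Omega -> Omega) : Prop :=
  let N := galois_closure in
  [/\ sigma @` N = N,
      forall x y, N x -> N y -> sigma (x + y) = sigma x + sigma y,
      forall x y, N x -> N y -> sigma (x * y) = sigma x * sigma y &
      forall a, sigma (j a) = j a].

Definition Mon : set (permutation embedding) :=
  [set s : permutation embedding | exists2 sigma, galois_aut sigma &
     forall (e : embedding) a, sval (s e) a = sigma (sval e a)].
End Monodromy.
Arguments Mon {K C D} phi {Omega} j _.
Arguments galois_closure {K C D} phi {Omega} j _.
Arguments galois_aut {K C D} phi {Omega} j _.

Definition set_order (T : choiceType) (A : set T) : nat := #|` fset_set A |.

(* Main.v *)
Require Import Defs.
From HB Require Import structures.
From mathcomp Require Import all_boot all_order all_algebra.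
From mathcomp Require Import separable fieldext ring.
From mathcomp Require Import finmap mpoly.
From mathcomp Require Import boolp classical_sets functions cardinality.

Set Implicit Arguments.
Unset Strict Implicit.
Unset Printing Implicit Defensive.

(* Let mu be an automorphism of phi. The stabilizer in a transitive subgroup
   G of Mon(phi) of a block of embeddings that agree on K(C_i) is normal
   because G is Dedekind, and mu commutes with G, so mu maps K(C_i) into the
   fixed field of the block, which is K(C_i) by separability. As curves are
   nonsingular and projective, automorphisms of K(C_i) over K come from
   automorphisms of C_i. Hence restriction is a homomorphism from
   Aut(psi_(i+1)) to Aut(phi_(i+1)), with kernel Aut(psi_i). This also makes
   sense for i = 0, where psi_0 is the identity, and the divisibility
   follows. *)

(** * Local rings and valuation rings inside a field *)

Section LocalSubrings.
Import GRing.Theory.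
Local Open Scope classical_set_scope.
Local Open Scope ring_scope.

(** A morphism carries a map on points besides its comorphism, so passing from K(C_i) back to C_i
    has to be earned. The link is valuation theory. Nonsingularity makes every local ring a
    valuation ring of the function field; projectivity makes every valuation ring containing K
    dominate the local ring of exactly one point, its centre; and valuation rings are maximal under
    domination, so on a curve the two rings coincide. Pulling local rings back along an embedding of
    function fields therefore defines the map on points, and uniqueness of centres shows that a
    morphism is determined by its comorphism. On the field side, extensions are maps rather than
    inclusions. The degrees in the decomposition provide finite lists of generators, and embeddings
    into [Omega] are extended one generator at a time, the base field growing at each step. An
    element of [Mon] acts on embeddings by composition with a map on values, which is why it
    commutes with precomposition by an automorphism. *)

Record local_subring (F : fieldType) (V M : set F) : Prop := LocalSubring {
  local1 : V 1;
  localB : forall a b, V a -> V b -> V (a - b);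
  localM : forall a b, V a -> V b -> V (a * b);
  localS : M `<=` V;
  local_max0 : M 0;
  local_maxD : forall a b, M a -> M b -> M (a + b);
  local_maxM : forall a b, V a -> M b -> M (a * b);
  local_maxN1 : ~ M 1;
  localV : forall a, V a -> ~ M a -> V a^-1 }.

(** For a local subring this is the valuation ring property. The whole field is allowed, as it is
    the local ring at the generic point. *)
Definition total_subring (F : fieldType) (V : set F) : Prop :=
  forall a, V a \/ V a^-1.

Section Theory.
Variables (F : fieldType) (V M : set F).
Hypothesis VM : local_subring V M.

Lemma local0 : V 0.
Proof. exact: (localS VM (local_max0 VM)). Qed.

Lemma localN a : V a -> V (- a).
Proof. by move=> Va; rewrite -sub0r; apply: (localB VM) => //; exact: local0. Qed.

Lemma localD a b : V a -> V b -> V (a + b).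
Proof. by move=> Va Vb; rewrite -[b]opprK; apply: (localB VM) => //; exact: localN. Qed.

Lemma localX a n : V a -> V (a ^+ n).
Proof.
move=> Va; elim: n => [|n IH]; first by rewrite expr0; exact: (local1 VM).
by rewrite exprS; apply: (localM VM).
Qed.

Lemma local_sum I (r : seq I) (P : pred I) (f : I -> F) :
  (forall i, P i -> V (f i)) -> V (\sum_(i <- r | P i) f i).
Proof. by move=> Vf; apply: (big_ind V) => //; [exact: local0 | exact: localD]. Qed.

Lemma local_max_sum I (r : seq I) (P : pred I) (f : I -> F) :
  (forall i, P i -> M (f i)) -> M (\sum_(i <- r | P i) f i).
Proof.
by move=> Vf; apply: (big_ind M) => //; [exact: (local_max0 VM) | exact: (local_maxD VM)].
Qed.

Lemma local_max_inv a : M a -> a != 0 -> ~ V a^-1.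
Proof.
move=> Ma a0 Va; apply: (local_maxN1 VM).
by rewrite -(mulVf a0); apply: (local_maxM VM).
Qed.

Lemma local_max_prime a b : V a -> V b -> M (a * b) -> M a \/ M b.
Proof.
move=> Va Vb Mab; case: (pselect (M a)) => Ma; first by left.
right; have a0 : a != 0 by apply/eqP => a0; apply: Ma; rewrite a0; exact: (local_max0 VM).
by rewrite -(mulKf a0 b); apply: (local_maxM VM) => //; apply: (localV VM).
Qed.

Lemma local_maxB a b : M a -> M b -> M (a - b).
Proof.
move=> Ma Mb; apply: (local_maxD VM) => //; rewrite -mulN1r.
by apply: (local_maxM VM) => //; apply: localN; exact: (local1 VM).
Qed.

(** Valuation rings are maximal under domination: if [a] in [V'] were outside [V], its inverse would
    be a nonunit of [V], hence in [M'], and 1 would be in [M']. *)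
Lemma total_subring_dominated V' M' : total_subring V -> local_subring V' M' ->
  V `<=` V' -> M `<=` M' -> V' = V /\ M' = M.
Proof.
move=> totV VM' sVV sMM.
have sVV' : V' `<=` V.
  move=> a V'a; case: (totV a) => // Va.
  have [->|a0] := eqVneq a 0; first exact: local0.
  rewrite -[a]invrK; apply: (localV VM) => // Ma; apply: (local_maxN1 VM').
  by rewrite -(mulfV a0); apply: (local_maxM VM') => //; exact: sMM.
split; apply/seteqP; split=> // a M'a.
case: (pselect (M a)) => // Ma.
have a0 : a != 0 by apply/eqP => a0; apply: Ma; rewrite a0; exact: (local_max0 VM).
have Va : V a by apply: sVV'; exact: (localS VM').
have V'a : V' a^-1 by apply: sVV; exact: (localV VM).
by case: (local_maxN1 VM'); rewrite -(mulVf a0); apply: (local_maxM VM').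
Qed.

(* Scaling by a coordinate of maximal pole order makes all coordinates integral. *)
Lemma total_subring_max n (y : 'I_n.+1 -> F) : total_subring V ->
  (exists i, y i != 0) -> exists2 j, y j != 0 & forall k, V (y k / y j).
Proof.
move=> totV [i0 yi0].
suff: forall s : seq 'I_n.+1, exists2 j, y j != 0 & forall k, k \in s -> V (y k / y j).
  by move=> /(_ (enum 'I_n.+1)) [j yj Vj]; exists j => // k; apply: Vj; rewrite mem_enum.
elim=> [|k s [j yj Vj]]; first by exists i0.
case: (pselect (V (y k / y j))) => Vk.
  by exists j => // l; rewrite inE => /orP[/eqP -> //|]; exact: Vj.
have yk : y k != 0 by apply/eqP => yk; apply: Vk; rewrite yk mul0r; exact: local0.
have Vjk : V (y j / y k) by case: (totV (y k / y j)) => //; rewrite invf_div.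
exists k => // l; rewrite inE => /orP[/eqP ->|/Vj Vl].
  by rewrite mulfV //; exact: (local1 VM).
have -> : y l / y k = (y l / y j) * (y j / y k) by field; rewrite yj yk.
by apply: (localM VM).
Qed.
End Theory.

Lemma local_subring_preim (E F : fieldType) (s : {rmorphism E -> F}) (V M : set F) :
  local_subring V M -> local_subring (s @^-1` V) (s @^-1` M).
Proof.
move=> VM; split=> /=.
- by rewrite rmorph1; exact: (local1 VM).
- by move=> a b Va Vb; rewrite /preimage /= rmorphB; exact: (localB VM Va Vb).
- by move=> a b Va Vb; rewrite /preimage /= rmorphM; exact: (localM VM Va Vb).
- by move=> a; exact: (localS VM).
- by rewrite /preimage /= rmorph0; exact: (local_max0 VM).
- by move=> a b Va Vb; rewrite /preimage /= rmorphD; exact: (local_maxD VM Va Vb).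
- by move=> a b Va Vb; rewrite /preimage /= rmorphM; exact: (local_maxM VM Va Vb).
- by rewrite /preimage /= rmorph1; exact: (local_maxN1 VM).
- by move=> a Va Ma; rewrite /preimage /= fmorphV; exact: (localV VM Va Ma).
Qed.

Lemma total_subring_preim (E F : fieldType) (s : {rmorphism E -> F}) (V : set F) :
  total_subring V -> total_subring (s @^-1` V).
Proof. by move=> totV a; rewrite /preimage /= fmorphV; exact: totV. Qed.

(* Noetherianity bounds the powers of a uniformizer [t] that divide [a]. *)
Lemma regular_local1_total (F : fieldType) (O m : set F) :
  local_subring O m -> regular_local1 O m ->
  (forall a, exists x y, [/\ O x, O y & a = x / y]) -> total_subring O.
Proof.
move=> Om [noeth [t mt tgen]] frac.
have Ot n : O (t ^+ n) by apply: (localX Om); exact: (localS Om).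
have unit_part a : O a -> a != 0 ->
    exists n u, [/\ O u, O u^-1, u != 0, t ^+ n != 0 & a = u * t ^+ n].
  move=> Oa a0; case: (pselect (m a)) => ma; last first.
    by exists 0%N, a; rewrite expr0 mulr1 oner_eq0; split=> //; exact: (localV Om).
  have t0 : t != 0.
    by apply: contra_neqN a0 => /eqP t0; have [c _ ->] := tgen _ ma; rewrite t0 mulr0.
  have nt n : t ^+ n != 0 by rewrite expf_neq0.
  have [n On NOn] : exists2 n, O (a / t ^+ n) & ~ O (a / t ^+ n.+1).
    apply: contrapT => noN.
    have allO n : O (a / t ^+ n).
      elim: n => [|n IH]; first by rewrite expr0 divr1.
      by apply: contrapT => NO; apply: noN; exists n.
    (* The elements that some power of [t] moves into the ideal generated by [a]; they include every
       [a / t ^+ n]. Finite generation gives one exponent [N] that works for all of [J]. For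
       [a / t ^+ N.+1] it makes [a / t] a multiple of [a], so the inverse of [t] would lie in
       [O]. *)
    pose J := [set b | O b /\ exists n c, O c /\ t ^+ n * b = c * a].
    have idJ : subring_ideal O J.
      split.
      - by move=> b [].
      - split; first exact: (local0 Om).
        by exists 0%N, 0; rewrite mulr0 mul0r; split=> //; exact: (local0 Om).
      - move=> b b' [Ob [n [c [Oc ec]]]] [Ob' [n' [c' [Oc' ec']]]].
        split; first exact: (localD Om).
        exists (n + n')%N, (t ^+ n' * c + t ^+ n * c'); split.
          by apply: (localD Om); apply: (localM Om).
        rewrite mulrDl -!mulrA -ec -ec' exprD.
        by rewrite mulrDr -!mulrA [in X in X + _]mulrCA.
      - move=> b b' Ob [Ob' [n [c [Oc ec]]]]; split; first exact: (localM Om).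
        exists n, (b * c); split; first exact: (localM Om).
        by rewrite mulrCA ec mulrA.
    have [s [sJ sgen]] := noeth _ idJ.
    have [N HN] : exists N, forall b, b \in s -> exists2 c, O c & t ^+ N * b = c * a.
      elim: s sJ {sgen} => [|b s IH] sJ; first by exists 0%N.
      have [|N HN] := IH; first by move=> b' b's; apply: sJ; rewrite inE b's orbT.
      have [_ [n [c [Oc ec]]]] := sJ b (mem_head _ _).
      exists (n + N)%N => b'; rewrite inE => /orP[/eqP ->|/HN [c' Oc' ec']].
        by exists (t ^+ N * c); [exact: (localM Om)|rewrite addnC exprD -mulrA ec mulrA].
      by exists (t ^+ n * c'); [exact: (localM Om)|rewrite exprD -mulrA ec' mulrA].
    have /sgen [c [Oc ec]] : J (a / t ^+ N.+1).
      split=> //; exists N.+1, 1; split; first exact: (local1 Om).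
      by rewrite mul1r mulrC mulfVK.
    have [d Od ed] : exists2 d, O d & t ^+ N * (a / t ^+ N.+1) = d * a.
      rewrite ec; apply: (big_ind (fun x => exists2 d, O d & t ^+ N * x = d * a)).
      - by exists 0; [exact: (local0 Om)|rewrite mulr0 mul0r].
      - move=> x y [dx Ox ex] [dy Oy ey]; exists (dx + dy); first exact: (localD Om).
        by rewrite mulrDr ex ey mulrDl.
      - move=> i _; have [d Od ed] := HN s`_i (mem_nth _ (ltn_ord i)).
        by exists (c i * d); [exact: (localM Om)|rewrite mulrCA ed mulrA].
    apply: (local_max_inv Om mt t0); suff -> : t^-1 = d by [].
    apply: (mulIf a0); rewrite -ed exprS invfM; move: (nt N) => tN.
    by rewrite [RHS]mulrC -!mulrA mulVf // mulr1 mulrC.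
  exists n, (a / t ^+ n).
  have Nm : ~ m (a / t ^+ n).
    move=> /tgen [c Oc ec]; apply: NOn; suff -> : a / t ^+ n.+1 = c by [].
    by rewrite exprSr invfM mulrA ec mulfK.
  by rewrite mulf_neq0 ?invr_eq0 //; split=> //; [exact: (localV Om)|rewrite mulfVK].
move=> a; have [->|a0] := eqVneq a 0; first by left; exact: (local0 Om).
have [x [y [Ox Oy ea]]] := frac a.
have x0 : x != 0 by apply: contra_neqN a0 => /eqP x0; rewrite ea x0 mul0r.
have y0 : y != 0 by apply: contra_neqN a0 => /eqP y0; rewrite ea y0 invr0 mulr0.
have [n [u [Ou Ou' u0 tn ex]]] := unit_part x Ox x0.
have [k [v [Ov Ov' v0 tk ey]]] := unit_part y Oy y0.
rewrite ea ex ey; have [le_kn|/ltnW le_nk] := leqP k n.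
  left; have -> : u * t ^+ n / (v * t ^+ k) = u * v^-1 * t ^+ (n - k).
    by rewrite -{1}(subnK le_kn) exprD; field; rewrite tk v0.
  by apply: (localM Om) => //; apply: (localM Om).
right; have -> : (u * t ^+ n / (v * t ^+ k))^-1 = v * u^-1 * t ^+ (k - n).
  have tkn : t ^+ (k - n) != 0.
    by move: tk; rewrite -{1}(subnK le_nk) exprD mulf_eq0 negb_or => /andP[].
  by rewrite -{1}(subnK le_nk) exprD; field; rewrite tn tkn u0 v0.
by apply: (localM Om) => //; apply: (localM Om).
Qed.
End LocalSubrings.

(** * Points of a projective variety and their local rings *)

Section Points.
Import GRing.Theory.
Local Open Scope classical_set_scope.
Local Open Scope ring_scope.
Variables (K : fieldType) (X : projvar K).

Local Notation point := Defs.point.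
Local Notation y := (@vcoord K X).

Local Notation "f ~~" := (mmap (vconst X) y f) (at level 2, format "f ~~").

Lemma point_ext (P Q : point X) : (forall f, pideal P f <-> pideal Q f) -> P = Q.
Proof.
move: P Q => [P pP sP] [Q pQ sQ] /= PQ.
have e : P = Q by apply/funext => f; apply/propext.
by subst Q; rewrite (Prop_irrelevance pP pQ) (Prop_irrelevance sP sQ).
Qed.

Lemma point_homog_ext (P Q : point X) :
  (forall d f, f \is d.-homog -> pideal P f <-> pideal Q f) -> P = Q.
Proof.
have sub (P' Q' : point X) : (forall d f, f \is d.-homog -> pideal P' f -> pideal Q' f) ->
    forall f, pideal P' f -> pideal Q' f.
  move=> PQ f Pf; rewrite (pihomog_partitionE (leqnn (mmeasure mdeg f))).
  apply: (big_ind (pideal Q')); [exact: (homog_prime0 (pideal_prime Q'))|..].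
    exact: (homog_primeD (pideal_prime Q')).
  move=> i _; apply: (PQ i); first exact: pihomogP.
  exact: (homog_primeH (pideal_prime P')).
move=> PQ; apply: point_ext => f.
by split; apply: sub => d g /PQ [].
Qed.

Lemma vcoordE i : ('X_i)~~ = y i.
Proof. by rewrite mmapX mmap1U. Qed.

Lemma homogXn i d : ('X_i : {mpoly K[(vdim X).+1]}) ^+ d \is d.-homog.
Proof.
have : ('X_i : {mpoly K[(vdim X).+1]}) \is 1.-homog by rewrite dhomogX /= mdeg1.
by move/(dhomogMn d); rewrite mul1n.
Qed.

Section At.
Variable P : point X.
Let Pprime := pideal_prime P.

Lemma point_eq0 d f : f \is d.-homog -> f~~ = 0 -> pideal P f.
Proof. by move=> df f0; apply: (@pideal_sub _ _ P); apply/(vanishP df). Qed.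

Lemma point_neq0 d f : f \is d.-homog -> ~ pideal P f -> f~~ != 0.
Proof. by move=> df Pf; apply/eqP => f0; apply/Pf/(point_eq0 df). Qed.

Lemma pointM f g : ~ pideal P f -> ~ pideal P g -> ~ pideal P (f * g).
Proof. by move=> Pf Pg /(homog_primeP Pprime) []. Qed.

Lemma point_mull f g : pideal P f -> pideal P (f * g).
Proof. by move=> Pf; rewrite mulrC; exact: (homog_primeM Pprime). Qed.

Lemma pointX f n : ~ pideal P f -> ~ pideal P (f ^+ n.+1).
Proof. by move=> Pf; elim: n => [|n IH]; rewrite ?expr1 // exprS; apply: pointM. Qed.

Lemma point1 : ~ pideal P 1.
Proof.
move=> P1; have [i] := homog_primeX Pprime; apply; rewrite -['X_i]mulr1.
exact: (homog_primeM Pprime).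
Qed.

Lemma point_expX i n : ~ pideal P 'X_i -> ~ pideal P ('X_i ^+ n).
Proof. by move=> Pi; case: n => [|n]; [rewrite expr0; exact: point1|exact: pointX]. Qed.

(** Independence of the representation: if the function is also [G' / H'] with [G'] in [P], then
    [G * H' - G' * H] vanishes at the generic point, hence lies in [P], and primality removes
    [H']. *)
Lemma local_max_ratio d G H : G \is d.-homog -> H \is d.-homog -> ~ pideal P H ->
  local_max P (G~~ / H~~) <-> pideal P G.
Proof.
move=> dG dH PH; split=> [[e [G' [H' [eG eH PG PH']]]]|PG]; last by exists d, G, H.
move=> /eqP; rewrite eqr_div ?(point_neq0 dH PH) ?(point_neq0 eH PH') //.
move=> /eqP eGH.
have : pideal P (G * H').
  rewrite -[G * H'](subrK (G' * H)); apply: (homog_primeD Pprime); last exact: point_mull.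
  apply: (@point_eq0 (d + e)); last by rewrite rmorphB !rmorphM /= eGH subrr.
  by apply: rpredB; [|rewrite addnC]; apply: dhomogM.
by case/(homog_primeP Pprime).
Qed.

Lemma local_ring_local : local_subring (local_ring P) (local_max P).
Proof.
split.
- exists 0%N, 1, 1; rewrite !dhomog1 rmorph1 divr1; split=> //; exact: point1.
- move=> _ _ [d [G [H [dG dH PH ->]]]] [e [G' [H' [eG eH PH' ->]]]].
  exists (d + e)%N, (G * H' - H * G'), (H * H'); split.
  + by rewrite rpredB // dhomogM.
  + by rewrite dhomogM.
  + exact: pointM.
  + by rewrite rmorphB !rmorphM /=; field; rewrite (point_neq0 dH PH) (point_neq0 eH PH').
- move=> _ _ [d [G [H [dG dH PH ->]]]] [e [G' [H' [eG eH PH' ->]]]].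
  exists (d + e)%N, (G * G'), (H * H'); split; rewrite ?dhomogM //; first exact: pointM.
  by rewrite !rmorphM /= mulf_div.
- by move=> _ [d [G [H [dG dH PG PH ->]]]]; exists d, G, H.
- exists 0%N, 0, 1; rewrite dhomog0 dhomog1 rmorph0 mul0r; split=> //; last exact: point1.
  exact: (homog_prime0 Pprime).
- move=> _ _ [d [G [H [dG dH PG PH ->]]]] [e [G' [H' [eG eH PG' PH' ->]]]].
  exists (d + e)%N, (G * H' + H * G'), (H * H'); split.
  + by rewrite rpredD // dhomogM.
  + by rewrite dhomogM.
  + by apply: (homog_primeD Pprime); [exact: point_mull|exact: (homog_primeM Pprime)].
  + exact: pointM.
  + by rewrite rmorphD !rmorphM /=; field; rewrite (point_neq0 dH PH) (point_neq0 eH PH').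
- move=> _ _ [d [G [H [dG dH PH ->]]]] [e [G' [H' [eG eH PG' PH' ->]]]].
  exists (d + e)%N, (G * G'), (H * H'); split; rewrite ?dhomogM //.
  + exact: (homog_primeM Pprime).
  + exact: pointM.
  + by rewrite !rmorphM /= mulf_div.
- have := local_max_ratio (dhomog1 _ _) (dhomog1 _ _) point1.
  by rewrite rmorph1 divr1 => -[m1 _] /m1; exact: point1.
- move=> _ [d [G [H [dG dH PH ->]]]] Nm; exists d, H, G; rewrite invf_div; split=> // PG.
  by apply: Nm; apply/(local_max_ratio dG dH PH).
Qed.

Lemma local_ring_const c : local_ring P (vconst X c).
Proof.
exists 0%N, c%:MP, 1; rewrite dhomog1 rmorph1 divr1 mmapC; split=> //; last exact: point1.
by rewrite -[c%:MP]mulr1 mul_mpolyC dhomogZ // dhomog1.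
Qed.

Lemma point_coord : exists i, ~ pideal P 'X_i.
Proof. exact: (homog_primeX Pprime). Qed.

Lemma local_ring_frac a : exists b c, [/\ local_ring P b, local_ring P c & a = b / c].
Proof.
have [d [G [H [dG dH IH ->]]]] := funfieldP a.
(* Dividing both forms by the [d]-th power of a coordinate that is nonzero at [P] makes them
   functions regular at [P]. *)
have [i Pi] := point_coord; have Pn := point_expX (n := d) Pi.
exists (G~~ / ('X_i ^+ d)~~), (H~~ / ('X_i ^+ d)~~); split.
- by exists d, G, ('X_i ^+ d); rewrite homogXn.
- by exists d, H, ('X_i ^+ d); rewrite homogXn.
- have H0 : H~~ != 0 by apply/eqP => /(vanishP dH).
  by field; rewrite H0 (point_neq0 (homogXn _ _) Pn).
Qed.

Lemma generic_local_ring : generic P -> local_ring P = setT.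
Proof.
move=> gP; apply/seteqP; split=> // a _.
by have [d [G [H [dG dH IH ->]]]] := funfieldP a; exists d, G, H; rewrite gP.
Qed.

(* As only the local ring enters here, the Zariski topology is determined by
   the local rings; this makes maps induced on function fields continuous. *)
Lemma point_homogP d f : f \is d.-homog ->
  pideal P f <-> (f~~ = 0 \/ exists k, ~ local_ring P (('X_k ^+ d)~~ / f~~)).
Proof.
move=> df; split=> [Pf|[f0|[k Ok]]].
- have [f0|f0] := eqVneq f~~ 0; [by left|right].
  have [k Pk] := point_coord; exists k => Ok.
  have Pn := point_expX (n := d) Pk; have n0 := point_neq0 (homogXn _ _) Pn.
  have /(local_maxM local_ring_local Ok) : local_max P (f~~ / ('X_k ^+ d)~~).
    by apply/(local_max_ratio df (homogXn _ _) Pn).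
  by rewrite mulrA mulfVK // mulfV //; exact: (local_maxN1 local_ring_local).
- exact: (point_eq0 df).
- apply: contrapT => Pf; apply: Ok; exists d, ('X_k ^+ d), f.
  by rewrite homogXn.
Qed.
End At.

(** The points where [a] is not regular are the common zeros of all its possible denominators. *)
Lemma zariski_closed_not_local_ring a : zariski_closed [set P : point X | ~ local_ring P a].
Proof.
exists [set H | exists d G, [/\ G \is d.-homog, H \is d.-homog & a = G~~ / H~~]].
apply/seteqP; split=> P /= NP.
  move=> H [d [G [dG dH e]]]; apply: contrapT => PH; apply: NP.
  by exists d, G, H.
by move=> [d [G [H [dG dH PH e]]]]; apply: PH; apply: NP; exists d, G.
Qed.

Lemma zariski_closed_setT : zariski_closed [set: point X].
Proof. by exists set0; apply/seteqP; split=> P // _ f. Qed.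

Lemma zariski_closed_set0 : zariski_closed (set0 : set (point X)).
Proof.
by exists [set 1]; apply/seteqP; split=> P //= /(_ 1 erefl); exact: point1.
Qed.

Lemma zariski_closedU (Z1 Z2 : set (point X)) :
  zariski_closed Z1 -> zariski_closed Z2 -> zariski_closed (Z1 `|` Z2).
Proof.
move=> [S1 ->] [S2 ->]; exists [set f * g | f in S1 & g in S2].
apply/seteqP; split=> P /=.
  case=> sP _ [f Sf [g Sg <-]]; first by apply: point_mull; exact: sP.
  by apply: (homog_primeM (pideal_prime P)); exact: sP.
move=> sP; case: (pselect (S1 `<=` P)) => [|/existsNP [f /not_implyP [Sf Pf]]]; first by left.
right=> g Sg; have : pideal P (f * g) by apply: sP; exists f => //; exists g.
by case/(homog_primeP (pideal_prime P)).
Qed.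

Lemma zariski_closed_exists (I : finType) (Z : I -> set (point X)) :
  (forall i, zariski_closed (Z i)) -> zariski_closed [set P | exists i, Z i P].
Proof.
move=> Zc; suff Zs (s : seq I) : zariski_closed [set P | exists2 i, i \in s & Z i P].
  have := Zs (enum I); congr zariski_closed; apply/seteqP; split=> P /=.
    by case=> i _ ?; exists i.
  by case=> i ?; exists i; rewrite ?mem_enum.
elim: s => [|i s IH].
  by have := zariski_closed_set0; congr zariski_closed; apply/seteqP; split=> P //= [].
have := zariski_closedU (Zc i) IH; congr zariski_closed; apply/seteqP; split=> P /=.
  by case=> [ZP|[k ks ZP]]; [exists i|exists k]; rewrite ?mem_head ?inE ?ks ?orbT.
by case=> k; rewrite inE => /orP[/eqP ->|ks] ?; [left|right; exists k].
Qed.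

Lemma zariski_closed_forall I (D : set I) (Z : I -> set (point X)) :
  (forall i, D i -> zariski_closed (Z i)) ->
  zariski_closed [set P | forall i, D i -> Z i P].
Proof.
move=> Zc; exists [set f | exists i, D i /\ forall P, Z i P -> pideal P f].
apply/seteqP; split=> P /= ZP.
  by move=> f [i [Di Zf]]; apply/Zf/ZP.
move=> i Di; have [S eS] := Zc i Di; rewrite eS /= => f Sf; apply: ZP.
by exists i; split=> // Q; rewrite eS /=; apply.
Qed.

(** Uniqueness of the centre. If [f] vanished at [P] only and ['X_k] at neither point, then
    [f / 'X_k ^+ d] would be in the maximal ideal at [P] and its inverse in the local ring at [Q],
    so 1 would be in [M]. The same trick with two coordinates produces the common [k]. *)
Lemma point_separated (V M : set (funfield X)) (P Q : point X) :
  local_subring V M ->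
  local_ring P `<=` V -> local_max P `<=` M ->
  local_ring Q `<=` V -> local_max Q `<=` M -> P = Q.
Proof.
move=> VM PV PM QV QM.
have chart (P' Q' : point X) j k : local_max P' `<=` M -> local_ring Q' `<=` V ->
    ~ pideal P' 'X_j -> ~ pideal Q' 'X_k -> ~ pideal P' 'X_k.
  move=> P'M Q'V Pj Qk Pk.
  have Pj1 : ~ pideal P' ('X_j ^+ 1) by rewrite expr1.
  have m : local_max P' (('X_k ^+ 1)~~ / ('X_j ^+ 1)~~).
    by apply/(local_max_ratio (homogXn _ _) (homogXn _ _) Pj1); rewrite expr1.
  have O : local_ring Q' (('X_j ^+ 1)~~ / ('X_k ^+ 1)~~).
    by exists 1%N, ('X_j ^+ 1), ('X_k ^+ 1); rewrite !homogXn; split=> //; rewrite expr1.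
  have := local_maxM VM (Q'V _ O) (P'M _ m).
  rewrite mulrA mulfVK ?mulfV ?(point_neq0 (homogXn _ _) Pj1) //.
    exact: (local_maxN1 VM).
  by apply: (point_neq0 (P := Q') (homogXn _ _)); rewrite expr1.
have [j Pj] := point_coord P; have [k Qk] := point_coord Q.
have Pk := chart P Q j k PM QV Pj Qk.
have sub (P' Q' : point X) d f : local_max P' `<=` M -> local_ring Q' `<=` V ->
    ~ pideal P' 'X_k -> ~ pideal Q' 'X_k -> f \is d.-homog -> pideal P' f -> pideal Q' f.
  move=> P'M Q'V P'k Q'k df P'f; apply: contrapT => Q'f.
  have P'n := point_expX (n := d) P'k; have Q'n := point_expX (n := d) Q'k.
  have m : local_max P' (f~~ / ('X_k ^+ d)~~).
    by apply/(local_max_ratio df (homogXn _ _) P'n).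
  have O : local_ring Q' (('X_k ^+ d)~~ / f~~).
    by exists d, ('X_k ^+ d), f; rewrite homogXn.
  have := local_maxM VM (Q'V _ O) (P'M _ m).
  rewrite mulrA mulfVK ?(point_neq0 df Q'f) // mulfV ?(point_neq0 (homogXn _ _) P'n) //.
  exact: (local_maxN1 VM).
by apply: point_homog_ext => d f df; split; apply: sub df.
Qed.

(* Properness: evaluating at coordinates [z] normalized to be integral, the  *)
(* centre consists of the [f] all of whose components vanish in [V / M]; the *)
(* variable of [{poly _}] keeps track of the degree.                         *)
Section Center.
Variables (V M : set (funfield X)).
Hypotheses (VM : local_subring V M) (totV : total_subring V).
Hypothesis constV : forall c, V (vconst X c).

Lemma center_exists : exists P : point X, local_ring P `<=` V /\ local_max P `<=` M.
Proof.
have [j y_j Vj] : exists2 j, y j != 0 & forall k, V (y k / y j).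
  apply: (total_subring_max VM) => //.
  have [i Ii] := homog_primeX (videal_prime X); exists i; apply/eqP => y_i; apply: Ii.
  by apply/(@vanishP _ X 1); rewrite ?dhomogX /= ?mdeg1 // vcoordE.
pose z k := y k / y j.
(* Coefficient [d] of [ev f] is the value at [z] of the degree [d] component of [f]. *)
pose ev := mmap (polyC \o vconst X) (fun k => z k *: 'X).
have mmap1_ev m : mmap1 (fun k => z k *: 'X) m = mmap1 z m *: 'X^(mdeg m).
  rewrite /mmap1 -mul_polyC rmorph_prod /= mdegE -prodrXr -big_split /=.
  by apply: eq_bigr => i _; rewrite -mul_polyC exprMn rmorphXn.
have mmap1_z m : mmap1 z m = mmap1 y m / y j ^+ mdeg m.
  rewrite /mmap1 mdegE -prodrXr -prodf_div; apply: eq_bigr => i _.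
  by rewrite expr_div_n.
have ev_homog d f : f \is d.-homog -> ev f = (f~~ / y j ^+ d) *: 'X^d.
  move=> /dhomogP df; rewrite /ev /mmap mulr_suml scaler_suml big_seq [RHS]big_seq.
  apply: eq_bigr => m mf; rewrite mmap1_ev /= mul_polyC scalerA mmap1_z.
  by rewrite (df m mf) mulrA.
have ev_sum I (r : seq I) (G : I -> {mpoly K[(vdim X).+1]}) :
    ev (\sum_(i <- r) G i) = \sum_(i <- r) ev (G i).
  by rewrite /ev raddf_sum.
have ev_pihomog d f : ev (pihomog mdeg d f) = (ev f)`_d *: 'X^d.
  rewrite [in RHS](pihomog_partitionE (leqnn (mmeasure mdeg f))) ev_sum coef_sum.
  rewrite scaler_suml.
  under eq_bigr => i _.
    rewrite (ev_homog i _ (pihomogP mdeg i f)) coefZ coefXn. over.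
  have [lt_d|ge_d] := ltnP d (mmeasure mdeg f); last first.
    rewrite big1 => [|i _]; last by rewrite gtn_eqF ?mulr0 ?scale0r // (leq_trans _ ge_d).
    have -> : pihomog mdeg d f = 0.
      rewrite /pihomog big_seq_cond big_pred0 // => m; apply/andP => -[mf /eqP em].
      by have := mmeasure_mnm_lt mdeg mf; rewrite em ltnNge ge_d.
    exact: raddf0.
  rewrite (bigD1 (Ordinal lt_d)) //= eqxx mulr1 big1 ?addr0 => [|i /negPf ne].
    by rewrite -/(ev _) (ev_homog d) // pihomogP.
  by rewrite eq_sym -val_eqE /= in ne; rewrite ne mulr0 scale0r.
have Vev f d : V (ev f)`_d.
  rewrite /ev /mmap coef_sum; apply: (local_sum VM) => m _.
  rewrite mmap1_ev /= mul_polyC scalerA coefZ.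
  apply: (localM VM); last first.
    by rewrite coefXn; case: (d == _); [exact: (local1 VM)|exact: (local0 VM)].
  apply: (localM VM) => //; rewrite /mmap1; apply: (big_ind V); [exact: (local1 VM)|..].
    exact: (localM VM).
  by move=> i _; apply: (localX VM); exact: Vj.
pose I := [set f | forall d, M (ev f)`_d].
have evM f g : ev (f * g) = ev f * ev g by rewrite /ev rmorphM.
have Iprime : homog_prime I.
  split.
  - by move=> d; rewrite /ev raddf0 coef0; exact: (local_max0 VM).
  - by move=> f g If Ig d; rewrite /ev raddfD coefD; exact: (local_maxD VM (If d) (Ig d)).
  - move=> f g Ig d; rewrite evM coefM; apply: (local_max_sum VM) => i _.
    exact: (local_maxM VM).
  (* As in Gauss's lemma: let [d] and [e] be the least degrees at which [f] and [g] escape [M]. In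
     coefficient [d + e] of the product all other terms have a factor in [M], so the remaining one
     lies in [M] too, against primality. *)
  - move=> f g Ifg; apply: contrapT => /not_orP [/existsNP exf /existsNP exg].
    have least h : (exists d, ~ M (ev h)`_d) ->
        exists d, ~ M (ev h)`_d /\ forall e, (e < d)%N -> M (ev h)`_e.
      move=> [d]; elim/ltn_ind: d => d IH Nd.
      case: (pselect (exists2 e, (e < d)%N & ~ M (ev h)`_e)) => [[e lt_ed]|no].
        exact: IH.
      by exists d; split=> // e lt_ed; apply: contrapT => Ne; apply: no; exists e.
    have [d [Nd mind]] := least f exf; have [e [Ne mine]] := least g exg.
    have := Ifg (d + e)%N; rewrite evM coefM.
    have lt_d : (d < (d + e).+1)%N by rewrite ltnS leq_addr.
    rewrite (bigD1 (Ordinal lt_d)) //= addKn => Msum.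
    have : M ((ev f)`_d * (ev g)`_e).
      rewrite -[X in M X](addrK (\sum_(i < (d + e).+1 | i != Ordinal lt_d)
        (ev f)`_i * (ev g)`_(d + e - i))).
      apply: (local_maxB VM) => //; apply: (local_max_sum VM) => i ne.
      have [lt_i|gt_i|eq_i] := ltngtP i d.
      + by rewrite mulrC; apply: (local_maxM VM) => //; exact: mind.
      + by apply: (local_maxM VM) => //; apply: mine; rewrite ltn_subLR ?ltn_add2r // -ltnS.
      + by rewrite -val_eqE /= eq_i eqxx in ne.
    by case/(local_max_prime VM).
  - move=> f d If e; rewrite ev_pihomog coefZ coefXn.
    by rewrite mulrC; apply: (local_maxM VM) => //; case: (e == d);
       [exact: (local1 VM)|exact: (local0 VM)].
  (* The normalized coordinate [z j] is 1, which is not in [M]. *)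
  - exists j => /(_ 1%N).
    rewrite (ev_homog 1%N) ?dhomogX /= ?mdeg1 // vcoordE expr1 mulfV // scale1r coefXn.
    exact: (local_maxN1 VM).
have I_homog d f : f \is d.-homog -> I f <-> M (f~~ / y j ^+ d).
  move=> df; rewrite /I /= (ev_homog d f df); split=> [/(_ d)|Mf e].
    by rewrite coefZ coefXn eqxx mulr1.
  rewrite coefZ coefXn mulrC; apply: (local_maxM VM) => //.
  by case: (e == d); [exact: (local1 VM)|exact: (local0 VM)].
have Isub : @videal K X `<=` I.
  move=> f Xf d; have := homog_primeH (videal_prime X) d Xf.
  move=> /(vanishP (pihomogP mdeg d f)) f0.
  have := ev_pihomog d f; rewrite (ev_homog d) ?pihomogP // f0 mul0r scale0r.
  move=> /(congr1 (fun p : {poly _} => p`_d)); rewrite coef0 coefZ coefXn eqxx mulr1 => <-.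
  exact: (local_max0 VM).
have V_homog d f : f \is d.-homog -> V (f~~ / y j ^+ d).
  by move=> df; have := Vev f d; rewrite (ev_homog d) // coefZ coefXn eqxx mulr1.
have ratio d G H : G~~ / H~~ = (G~~ / y j ^+ d) * (H~~ / y j ^+ d)^-1.
  by rewrite invf_div mulrA mulfVK // expf_neq0.
exists (Point Iprime Isub); split=> a [d [G [H]]] /=.
  move=> [dG dH /(I_homog d _ dH) IH ->]; rewrite (ratio d).
  by apply: (localM VM); [exact: V_homog|apply: (localV VM) => //; exact: V_homog].
move=> [dG dH /(I_homog d _ dG) IG /(I_homog d _ dH) IH ->]; rewrite (ratio d) mulrC.
by apply: (local_maxM VM) => //; apply: (localV VM) => //; exact: V_homog.
Qed.
End Center.
End Points.

(** * Morphisms of curves and embeddings of function fields *)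

Section CurveMorphisms.
Import GRing.Theory.
Local Open Scope classical_set_scope.
Local Open Scope ring_scope.

Lemma rmorph_factor (R : nzRingType) (A B : fieldType) (f : {rmorphism A -> B})
    (g : {rmorphism R -> B}) : (forall x, exists y, f y = g x) ->
  exists h : {rmorphism R -> A}, forall x, f (h x) = g x.
Proof.
move=> /choice [h fh].
have hB : {morph h : x y / x - y}.
  by move=> x y; apply: (fmorph_inj f); rewrite rmorphB !fh rmorphB.
have hM : monoid_morphism h.
  by split=> [|x y]; apply: (fmorph_inj f); rewrite ?rmorph1 ?rmorphM !fh ?rmorph1 ?rmorphM.
pose hm : {rmorphism R -> A} := HB.pack h (GRing.isZmodMorphism.Build R A h hB)
  (GRing.isMonoidMorphism.Build R A h hM).
by exists hm.
Qed.

Variable K : fieldType.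
Local Notation point := Defs.point.

Lemma local_ring_total (C : curve K) (P : point C) : total_subring (local_ring P).
Proof.
case: (pselect (generic P)) => gP; first by rewrite generic_local_ring // => a; left.
apply: (regular_local1_total (local_ring_local P)); last exact: local_ring_frac.
exact: curve_nonsingular gP.
Qed.

(** Both images of [P] are centres of the same ring, the local ring of [P] pulled back to K(D). *)
Lemma mor_comorphism_inj (C D : curve K) (f g : mor C D) : mcom f =1 mcom g -> f = g.
Proof.
move=> fg; apply: mor_ext => // P.
apply: (point_separated (local_subring_preim (mcom f) (local_ring_local P))) => a.
- exact: mcom_stalk.
- exact: mcom_local.
- by rewrite /preimage /= fg; exact: mcom_stalk.
- by rewrite /preimage /= fg; exact: mcom_local.
Qed.

(** The image of [P] is the centre of its local ring pulled back along [s]. Maximality under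
    domination makes the pulled back ring equal to the local ring of the centre; continuity needs
    this equality, since it translates closed conditions stated through local rings. *)
Lemma mor_of_comorphism (C D : curve K) (s : {rmorphism funfield D -> funfield C}) :
  (forall c, s (vconst D c) = vconst C c) -> exists m : mor C D, mcom m = s.
Proof.
move=> s_const.
have ex P : exists Q : point D, s @^-1` local_ring P = local_ring Q /\
    s @^-1` local_max P = local_max Q.
  have VM := local_subring_preim s (local_ring_local P).
  have totV := total_subring_preim s (@local_ring_total _ P).
  have [|Q [QV QM]] := center_exists VM totV.
    by move=> c; rewrite /preimage /= s_const; exact: local_ring_const.
  exists Q; exact: (total_subring_dominated (local_ring_local Q) (@local_ring_total _ Q) VM).
have [p sp] := choice ex.
have sO P a : local_ring (p P) a = local_ring P (s a) by rewrite -(sp P).1.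
have sM P a : local_max (p P) a = local_max P (s a) by rewrite -(sp P).2.
have cont Z : zariski_closed Z -> zariski_closed (p @^-1` Z).
  move=> [S ->].
  (* The ideals of points contain a polynomial exactly when they contain its components, so [S] may
     be replaced by forms, for which vanishing can be read off local rings. *)
  pose T := [set df : nat * {mpoly K[(vdim D).+1]} | df.2 \is df.1.-homog /\
    exists2 f, S f & df.2 = pihomog mdeg df.1 f].
  have -> : p @^-1` [set P | S `<=` pideal P] =
      [set P | forall df, T df -> pideal (p P) df.2].
    apply/seteqP; split=> P /= SP.
      by move=> [d _] [_ [f /SP Pf /= ->]]; exact: (homog_primeH (pideal_prime (p P))).
    move=> f Sf; rewrite (pihomog_partitionE (leqnn (mmeasure mdeg f))).
    apply: (big_ind (pideal (p P))); [exact: (homog_prime0 (pideal_prime (p P)))|..].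
      exact: (homog_primeD (pideal_prime (p P))).
    move=> i _; apply: (SP (i : nat, _)); split; first exact: pihomogP.
    by exists f.
  apply: zariski_closed_forall => -[d f] [/= df _].
  have [f0|f0] := pselect (mmap (vconst D) (@vcoord K D) f = 0).
    have := zariski_closed_setT C; congr zariski_closed; apply/seteqP; split=> P // _.
    by apply/(point_homogP _ df); left.
  have := zariski_closed_exists (fun k : 'I_(vdim D).+1 => zariski_closed_not_local_ring
    (s (mmap (vconst D) (@vcoord K D) ('X_k ^+ d) / mmap (vconst D) (@vcoord K D) f))).
  congr zariski_closed; apply/seteqP; split=> P /=.
    by move=> [k NO]; apply/(point_homogP _ df); right; exists k; rewrite sO.
  by move=> /(point_homogP _ df) [//|[k]]; rewrite sO; exists k.
have stalk P a : local_ring (p P) a -> local_ring P (s a) by rewrite sO.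
have loc P a : local_max (p P) a -> local_max P (s a) by rewrite sM.
by exists (Mor s_const cont stalk loc).
Qed.

Lemma aut_of_comorphism (C : curve K) (s t : {rmorphism funfield C -> funfield C}) :
  (forall c, s (vconst C c) = vconst C c) -> cancel s t -> cancel t s ->
  exists mu : aut C, mcom mu = s.
Proof.
move=> s_const sK tK.
have [m em] := mor_of_comorphism s_const.
have [|m' em'] := @mor_of_comorphism C C t; first by move=> c; rewrite -{1}s_const sK.
have mK : mor_comp m' m = mor_id C by apply: mor_comorphism_inj => a /=; rewrite em em' tK.
have m'K : mor_comp m m' = mor_id C by apply: mor_comorphism_inj => a /=; rewrite em em' sK.
by exists (MkAut mK m'K).
Qed.

Lemma mor_comp_epi (B C D : curve K) (f : mor B C) (g h : mor C D) :
  mor_comp g f = mor_comp h f -> g = h.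
Proof.
move=> gfh; apply: mor_comorphism_inj => a; apply: (fmorph_inj (mcom f)).
by have /(congr1 (fun k => mcom k a)) := gfh.
Qed.

Lemma ainv_aut (C D : curve K) (phi : mor C D) (mu : aut C) :
  Aut phi mu -> mor_comp phi (ainv mu) = phi.
Proof. by move=> e; rewrite -[in LHS]e -mor_compA amorK mor_comp1. Qed.

Lemma ainvKE (C : curve K) (mu : aut C) : cancel (mcom mu) (mcom (ainv mu)).
Proof. by move=> a; have /(congr1 (fun k => mcom k a)) := amorK mu. Qed.

Lemma amorKE (C : curve K) (mu : aut C) : cancel (mcom (ainv mu)) (mcom mu).
Proof. by move=> a; have /(congr1 (fun k => mcom k a)) := ainvK mu. Qed.

(** Stability under the inverse of [mu] is what provides an inverse to the map induced on K(D). *)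
Lemma aut_descends (C D : curve K) (phi : mor C D) (mu : aut C) :
  (forall x, exists y, mcom phi y = mcom mu (mcom phi x)) ->
  (forall x, exists y, mcom phi y = mcom (ainv mu) (mcom phi x)) ->
  exists nu : aut D, mor_comp phi mu = mor_comp nu phi.
Proof.
move=> /(@rmorph_factor _ _ _ (mcom phi) (mcom mu \o mcom phi)) [s sE].
move=> /(@rmorph_factor _ _ _ (mcom phi) (mcom (ainv mu) \o mcom phi)) [t tE].
have inj := fmorph_inj (mcom phi).
have [|||nu nuE] := @aut_of_comorphism D s t.
- by move=> c; apply: inj; rewrite sE /= !mcom_const.
- by move=> x; apply: inj; rewrite tE /= sE /= ainvKE.
- by move=> x; apply: inj; rewrite sE /= tE /= amorKE.
by exists nu; apply: mor_comorphism_inj => a /=; rewrite nuE sE.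
Qed.
End CurveMorphisms.

(** * Counting by enumeration *)

Section SetOrder.
Local Open Scope classical_set_scope.

Lemma set_order_seq (T : choiceType) (A : set T) (s : seq T) :
  uniq s -> (forall x, A x <-> x \in s) -> finite_set A /\ set_order A = size s.
Proof.
move=> us As; have -> : A = [set` [fset x in s]%fset].
  by apply/seteqP; split=> x /=; rewrite inE /= => /As.
split; first exact: finite_fset.
rewrite /set_order set_fsetK; apply: perm_size; apply: uniq_perm => //.
by move=> x; rewrite inE.
Qed.

Lemma finite_set_enum (T : choiceType) (A : set T) : finite_set A ->
  exists s : seq T, [/\ uniq s, forall x, A x <-> x \in s & set_order A = size s].
Proof.
move=> finA; exists (enum_fset (fset_set A)); split=> // x.
by rewrite in_fset_set // inE.
Qed.

Lemma seq_lift (T U : eqType) (A : set T) (f : T -> U) (s : seq U) :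
  (forall y, y \in s -> exists2 x, A x & f x = y) ->
  exists2 r, map f r = s & forall x, x \in r -> A x.
Proof.
elim: s => [|y s IH] sf; first by exists [::].
have [x Ax fx] := sf y (mem_head _ _).
have [|r fr Ar] := IH; first by move=> z zs; apply: sf; rewrite inE zs orbT.
exists (x :: r); first by rewrite /= fx fr.
by move=> z; rewrite inE => /orP[/eqP ->|/Ar].
Qed.

Lemma uniq_map_inj (T U : eqType) (f : T -> U) (r : seq T) :
  uniq (map f r) -> {in r &, injective f}.
Proof.
elim: r => [|z r IH] //= /andP[zr ur] x y; rewrite !inE.
move=> /orP[/eqP ->|xr] /orP[/eqP ->|yr] // fxy; last exact: IH.
  by rewrite fxy map_f in zr.
by rewrite -fxy map_f in zr.
Qed.

Lemma set_order_bij (T U : choiceType) (A : set T) (B : set U) (f : T -> U) :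
  set_bij A B f -> finite_set B -> finite_set A /\ set_order A = set_order B.
Proof.
move=> [fAB finj fsurj] finB; have [s [us Bs ->]] := finite_set_enum finB.
have [|r fr Ar] := @seq_lift _ _ A f s; first by move=> y /Bs /fsurj.
rewrite -fr size_map; apply: set_order_seq; first by apply: (@map_uniq _ _ f); rewrite fr.
move=> x; split=> [Ax|/Ar //].
have /Bs : B (f x) by exact: fAB.
rewrite -fr => /mapP [z zr fxz].
by rewrite (finj x z) // inE //; exact: Ar.
Qed.
End SetOrder.

(** * Cosets and Lagrange's theorem *)

Section Cosets.
Local Open Scope classical_set_scope.
Local Open Scope group_scope.
Variable gT : groupType.
Implicit Types A B : set gT.

Lemma set_mul1P B (a x : gT) : set_mul [set a] B x <-> B (a^-1 * x).
Proof.
split=> [[_ -> [b Bb <-]]|Bx]; first by rewrite mulKg.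
by exists a => //; exists (a^-1 * x); rewrite ?mulVKg.
Qed.

Lemma set_mul1_eq B (a b : gT) : subgroup B ->
  set_mul [set a] B = set_mul [set b] B <-> B (a^-1 * b).
Proof.
move=> [B1 BM BV]; split=> [eab|Bab].
  by apply/set_mul1P; rewrite eab; apply/set_mul1P; rewrite mulVg.
apply/seteqP; split=> x /set_mul1P Bx; apply/set_mul1P.
  have -> : b^-1 * x = (a^-1 * b)^-1 * (a^-1 * x) by rewrite invgM invgK -mulgA mulVKg.
  by apply: BM => //; exact: BV.
have -> : a^-1 * x = (a^-1 * b) * (b^-1 * x) by rewrite -mulgA mulVKg.
exact: BM.
Qed.

(** Coset representatives times elements of [B] enumerate [A] without repetition. Finiteness of [A]
    is a conclusion, so that it can be carried up the decomposition. *)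
Lemma set_order_quotient A B : subgroup A -> subgroup B -> B `<=` A ->
  finite_set B -> finite_set (quotient A B) ->
  finite_set A /\ set_order A = (set_order B * set_order (quotient A B))%N.
Proof.
move=> [A1 AM AV] sB sBA finB finQ.
have [s [us Bs ->]] := finite_set_enum finB.
have [q [uq Qq ->]] := finite_set_enum finQ.
have [|r fr Ar] := @seq_lift _ _ A (fun a => set_mul [set a] B) q.
  by move=> U /Qq [a Aa <-]; exists a.
rewrite -fr in uq; have rinj := uniq_map_inj uq.
have -> : (size s * size q)%N = size [seq a * b | a <- r, b <- s].
  by rewrite size_allpairs -fr size_map mulnC.
have [B1 BM BV] := sB.
apply: set_order_seq.
  apply: allpairs_uniq => //; first exact: map_uniq uq.
  move=> _ _ /allpairsP [[a b] [/= ar bs ->]] /allpairsP [[c d] [/= cr ds ->]] /= e.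
  have eac : a = c.
    apply: rinj => //; apply/(set_mul1_eq _ _ sB).
    have -> : a^-1 * c = b * d^-1 by rewrite -[c](mulgK d) -e -!mulgA mulKg.
    by apply: BM; [apply/Bs|apply/BV/Bs].
  by move: e; rewrite eac => /mulgI ->.
move=> x; split=> [Ax|/allpairsP [[a b] [/= /Ar Aa /Bs /sBA Ab ->]]]; last exact: AM.
have : set_mul [set x] B \in q by apply/Qq; exists x.
rewrite -fr => /mapP [a ar /esym /(set_mul1_eq _ _ sB) Bax].
by apply/allpairsP; exists (a, a^-1 * x); rewrite /= mulVKg; split=> //; apply/Bs.
Qed.

Lemma lagrange A B : subgroup A -> subgroup B -> B `<=` A -> finite_set A ->
  (set_order B %| set_order A)%N.
Proof.
move=> sA sB sBA finA.
have [|_ ->] := set_order_quotient sA sB sBA (sub_finite_set sBA finA).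
  exact: finite_image.
exact: dvdn_mulr.
Qed.
End Cosets.

(** * The first isomorphism theorem for a map multiplicative on [A] *)

Section FirstIsomorphism.
Local Open Scope classical_set_scope.
Local Open Scope group_scope.
Variables (gT rT : groupType) (A B : set gT) (D : set rT) (r : gT -> rT).
Hypotheses (sA : subgroup A) (sBA : B `<=` A).
Hypothesis rM : forall x y, A x -> A y -> r (x * y) = r x * r y.
Hypothesis rD : forall x, A x -> D (r x).
Hypothesis kerr : forall x, A x -> B x <-> r x = 1.

Let r1 : r 1 = 1.
Proof. by have [A1 _ _] := sA; apply: (mulgI (r 1)); rewrite -rM // !mulg1. Qed.

Let rV x : A x -> r x^-1 = (r x)^-1.
Proof.
have [_ _ AV] := sA; move=> Ax; apply: (mulgI (r x)).
by rewrite -rM ?mulgV //; exact: AV.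
Qed.

Lemma kernel_normal : normal_subgroup B A.
Proof.
have [A1 AM AV] := sA; split=> //.
  split; first exact/(kerr A1).
    move=> x y Bx By; have Ax := sBA Bx; have Ay := sBA By.
    by apply/(kerr (AM _ _ Ax Ay)); rewrite rM // (kerr Ax).1 // (kerr Ay).1 // mulg1.
  move=> x Bx; have Ax := sBA Bx.
  by apply/(kerr (AV _ Ax)); rewrite rV // (kerr Ax).1 // invg1.
move=> a b Aa Bb; have Ab := sBA Bb; rewrite conjgE.
have Aab : A (b * a) by exact: AM.
apply/kerr; first by apply: AM => //; exact: AV.
by rewrite !rM ?rV //; [rewrite (kerr Ab).1 // mul1g mulVg|exact: AV].
Qed.

Lemma quotient_iso_image : quotient_iso_subgroup A B D.
Proof.
have [A1 AM AV] := sA; have [sB _ nB] := kernel_normal.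
have rE a b : A a -> A b -> set_mul [set a] B = set_mul [set b] B <-> r a = r b.
  move=> Aa Ab; rewrite set_mul1_eq // kerr; last by apply: AM => //; exact: AV.
  rewrite rM ?rV //; last exact: AV.
  split=> [e|->]; last by rewrite mulVg.
  by rewrite -[r b](mulVKg (r a)) e mulg1.
(* [f] has to be defined on all sets; away from the cosets its value is arbitrary. *)
have [f fE] : exists f : set gT -> rT, forall a, A a -> f (set_mul [set a] B) = r a.
  have /choice [f fE] : forall U : set gT, exists y, forall a, A a ->
      U = set_mul [set a] B -> y = r a.
    move=> U; case: (pselect (exists2 a, A a & U = set_mul [set a] B)).
      by move=> [a Aa ->]; exists (r a) => b Ab /rE; apply.
    by move=> no; exists 1 => a Aa e; case: no; exists a.
  by exists f => a Aa; apply: (fE _ a).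
exists [set r a | a in A], f; split.
- split; first by exists 1.
    by move=> _ _ [a Aa <-] [b Ab <-]; exists (a * b); rewrite ?rM //; exact: AM.
  by move=> _ [a Aa <-]; exists a^-1; rewrite ?rV //; exact: AV.
- by move=> _ [a Aa <-]; exact: rD.
- split.
  + by move=> _ [a Aa <-] /=; exists a; rewrite ?fE.
  + move=> _ _ /set_mem [a Aa <-] /set_mem [b Ab <-]; rewrite !fE // => e.
    exact/rE.
  + by move=> _ [a Aa <-]; exists (set_mul [set a] B); [exists a|exact: fE].
- move=> _ _ [a Aa <-] [b Ab <-]; rewrite !fE // -rM // -fE; last exact: AM.
  congr f; apply/seteqP; split=> x.
    move=> [_ [_ -> [c Bc <-]] [_ [_ -> [d Bd <-]] <-]]; apply/set_mul1P.
    have [B1 BM BV] := sB.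
    have -> : (a * b)^-1 * (a * c * (b * d)) = (c ^ b) * d.
      by rewrite conjgE invgM -!mulgA mulKg.
    by apply: BM => //; exact: nB.
  move=> /set_mul1P Bx; have [B1 BM BV] := sB.
  exists a; first by exists a => //; exists 1; rewrite ?mulg1.
  exists (b * ((a * b)^-1 * x)); first by exists b => //; exists ((a * b)^-1 * x).
  by rewrite mulgA mulVKg.
Qed.
End FirstIsomorphism.

Lemma quotient_iso_finite (gT rT : groupType) (A B : set gT) (D : set rT) :
  subgroup A -> normal_subgroup B A -> subgroup D -> quotient_iso_subgroup A B D ->
  finite_set B -> finite_set D ->
  finite_set A /\ set_order A %| set_order B * set_order D.
Proof.
move=> sA [sB sBA _] sD [H [f [sH sHD fbij _]]] finB finD.
have [finQ eQ] := set_order_bij fbij (sub_finite_set sHD finD).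
have [finA ->] := set_order_quotient sA sB sBA finB finQ.
by split=> //; rewrite eQ dvdn_mul // lagrange.
Qed.

(** * Extending and separating embeddings of fields *)

Section FieldEmbeddings.
Import GRing.Theory.
Local Open Scope classical_set_scope.
Local Open Scope ring_scope.

Definition algebraic_ext (E F : fieldType) (iota : {rmorphism E -> F}) : Prop :=
  forall a : F, exists2 p : {poly E}, p != 0 & root (map_poly iota p) a.

(** Generation as a field, tested on subfields instead of rational expressions, so that it passes
    easily to larger base fields and to towers. *)
Definition generates (E F : fieldType) (iota : {rmorphism E -> F}) (s : seq F) : Prop :=
  forall S : set F, is_subfield S -> range iota `<=` S -> [set` s] `<=` S -> forall x, S x.

Lemma separable_ext_algebraic (E F : fieldType) (iota : {rmorphism E -> F}) :
  separable_ext iota -> algebraic_ext iota.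
Proof.
by move=> sep a; have [p /separable_poly_neq0 p0 pa] := sep a; exists p.
Qed.

Lemma minimal_polynomial (E F : fieldType) (iota : {rmorphism E -> F}) (p : {poly E}) a :
  p != 0 -> root (map_poly iota p) a ->
  exists q : {poly E}, [/\ q != 0, root (map_poly iota q) a &
    forall h, root (map_poly iota h) a -> q %| h].
Proof.
elim/ltn_ind: {p}(size p) {-2}p (erefl (size p)) => n IH p sz p0 pa.
case: (pselect (exists h, [/\ h != 0, root (map_poly iota h) a & (size h < n)%N])).
  by move=> [h [h0 ha lt_h]]; exact: (IH _ lt_h h).
move=> no; exists p; split=> // h ha; apply: contrapT => /negP ndvd; apply: no.
exists (h %% p); split.
- by move: ndvd; rewrite /dvdp.
- have /(congr1 (map_poly iota)) := divp_eq h p.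
  move=> e; move: ha; rewrite e rmorphD rmorphM /= !rootE hornerD hornerM.
  by rewrite (rootP pa) mulr0 add0r.
- by rewrite -sz ltn_modp.
Qed.

Lemma root_size_gt1_map (E F : fieldType) (iota : {rmorphism E -> F}) (p : {poly E}) a :
  p != 0 -> root (map_poly iota p) a -> (1 < size p)%N.
Proof.
by move=> p0 pa; rewrite -(size_map_poly iota) (root_size_gt1 _ pa) ?map_poly_eq0.
Qed.

(** The universal property of E[X]/(p), with [M] a model of E(a): polynomials with equal values at
    [a] differ by a multiple of [p], which vanishes at [b]. As a field of its own, [M] can become
    the base field in inductions. *)
Lemma simple_embedding (E F L : fieldType) (iota : {rmorphism E -> F})
    (tau : {rmorphism E -> L}) (p : {poly E}) (a : F) (b : L) :
  p != 0 -> root (map_poly iota p) a ->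
  (forall h, root (map_poly iota h) a -> p %| h) -> root (map_poly tau p) b ->
  exists (M : fieldType) (i : {rmorphism E -> M}) (f : {rmorphism M -> F})
      (g : {rmorphism M -> L}),
    [/\ forall c, f (i c) = iota c, forall c, g (i c) = tau c &
        exists2 z, f z = a & g z = b].
Proof.
move=> p0 pa pmin pb.
pose M := subFExtend iota a p; pose ev := @subfx_eval _ _ iota a p.
have evE h : subfx_inj (ev h) = (map_poly iota h).[a] by exact: subfx_inj_eval.
have /choice [q qK] : forall z : M, exists h, z = ev h by move=> z; exact: subfxE.
pose g z := (map_poly tau (q z)).[b].
have gev h : g (ev h) = (map_poly tau h).[b].
  have /pmin /dvdpP [k] : root (map_poly iota (q (ev h) - h)) a.
    by rewrite rootE rmorphB hornerD hornerN -!evE -qK subrr.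
  move=> /(congr1 (fun r => (map_poly tau r).[b])).
  rewrite rmorphB rmorphM hornerM (rootP pb) mulr0 hornerD hornerN.
  by move/eqP; rewrite subr_eq0 => /eqP.
have gB : {morph g : x y / x - y}.
  move=> x y; rewrite {1}[x]qK {1}[y]qK -rmorphB gev rmorphB hornerD hornerN.
  by [].
have gM : monoid_morphism g.
  split=> [|x y].
    have e1 : ev 1 = 1 by exact: rmorph1.
    by rewrite -e1 gev rmorph1 hornerC.
  by rewrite {1}[x]qK {1}[y]qK -rmorphM gev rmorphM hornerM.
pose gm : {rmorphism M -> L} := HB.pack g (GRing.isZmodMorphism.Build M L g gB)
  (GRing.isMonoidMorphism.Build M L g gM).
exists M, (@inj_subfx _ _ iota a p), (@subfx_inj _ _ iota a p), gm; split.
- by move=> c; rewrite /= evE map_polyC hornerC.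
- by move=> c; rewrite /= gev map_polyC hornerC.
- by exists (ev 'X); rewrite /= ?evE ?gev map_polyX hornerX.
Qed.

Lemma generates_nil_surj (E F : fieldType) (iota : {rmorphism E -> F}) :
  generates iota [::] -> forall x, exists y, iota y = x.
Proof.
move=> gen x; suff [y _ <-] : range iota x by exists y.
apply: gen => [|//|y]; last by rewrite /= in_nil.
split; first by exists 1; rewrite ?rmorph1.
  by move=> _ _ [u _ <-] [v _ <-]; exists (u - v); rewrite ?rmorphB.
by move=> _ _ [u _ <-] [v _ <-]; exists (u / v); rewrite ?fmorph_div.
Qed.

Lemma algebraic_ext_over (E M F : fieldType) (iota : {rmorphism E -> F})
    (i : {rmorphism E -> M}) (f : {rmorphism M -> F}) :
  (forall c, f (i c) = iota c) -> algebraic_ext iota -> algebraic_ext f.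
Proof.
move=> fi alg a; have [p p0 pa] := alg a; exists (map_poly i p).
  by rewrite map_poly_eq0.
by rewrite -map_poly_comp (eq_map_poly (g := iota)).
Qed.

(** The first generator goes to a root in [Omega] of its transported minimal polynomial, and the
    induction continues over the field it generates; hence [E] varies with [s]. *)
Lemma embedding_extends (F : fieldType) (Omega : closedFieldType) (s : seq F)
    (E : fieldType) (iota : {rmorphism E -> F}) (tau : {rmorphism E -> Omega}) :
  algebraic_ext iota -> generates iota s ->
  exists e : {rmorphism F -> Omega}, forall c, e (iota c) = tau c.
Proof.
elim: s E iota tau => [|a s IH] E iota tau alg gen.
  have /(@rmorph_factor _ _ _ iota idfun) [h hK] := generates_nil_surj gen.
  exists (tau \o h) => c; apply: (congr1 tau); apply: (fmorph_inj iota).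
  by rewrite hK.
have [q q0 qa] := alg a; have [p [p0 pa pmin]] := minimal_polynomial q0 qa.
have /closed_rootP [b pb] : size (map_poly tau p) != 1%N.
  by rewrite size_map_poly gtn_eqF // (root_size_gt1_map p0 pa).
have [M [i [f [g [fi gi [z fz gz]]]]]] := simple_embedding p0 pa pmin pb.
have [||e eE] := IH M f g; first exact: algebraic_ext_over fi alg.
  move=> S sS fS sS'; apply: gen => //.
    by move=> _ [c _ <-]; apply: fS; exists (i c).
  move=> x /=; rewrite inE => /orP[/eqP ->|]; last exact: sS'.
  by apply: fS; exists z.
by exists e => c; rewrite -fi eE gi.
Qed.

(* If [x] is not in the base field, its minimal polynomial has a second root. *)
Lemma embedding_separates (E F : fieldType) (Omega : closedFieldType) (s : seq F)
    (iota : {rmorphism E -> F}) (e0 : {rmorphism F -> Omega}) (x : F) :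
  separable_ext iota -> generates iota s -> (forall c, iota c != x) ->
  exists2 e : {rmorphism F -> Omega}, forall c, e (iota c) = e0 (iota c) & e x != e0 x.
Proof.
move=> sep gen Nx; have [q qsep qx] := sep x.
have [p [p0 px pmin]] := minimal_polynomial (separable_poly_neq0 qsep) qx.
have psep := dvdp_separable (pmin _ qx) qsep.
pose tau : {rmorphism E -> Omega} := e0 \o iota.
have ptau : map_poly tau p = map_poly e0 (map_poly iota p) by rewrite map_poly_comp.
have : root (map_poly tau p) (e0 x) by rewrite ptau fmorph_root.
move=> /factor_theorem [r er].
(* If [p] had degree 1, its root [x] would be [- (p]_0 / p[_1)], in the image of [E]. *)
have sz_p : (2 < size p)%N.
  rewrite ltn_neqAle (root_size_gt1_map p0 px) andbT; apply/eqP => sz2.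
  have p1 : p`_1 != 0 by have := p0; rewrite -lead_coef_eq0 lead_coefE -sz2.
  move: px; rewrite rootE horner_coef size_map_poly -sz2 big_ord_recl big_ord1 /=.
  rewrite !coef_map expr0 expr1 mulr1 /= addr_eq0 => /eqP e.
  have := Nx (- (p`_0 / p`_1)); rewrite rmorphN fmorph_div.
  rewrite e mulNr opprK mulrAC mulfV ?mul1r ?eqxx //.
  by rewrite fmorph_eq0.
have r0 : r != 0.
  by apply: contra_neq p0 => r0; move/eqP: er; rewrite r0 mul0r map_poly_eq0 => /eqP.
have /closed_rootP [b rb] : size r != 1%N.
  have : size (map_poly tau p) = (size r).+1 by rewrite er size_Mmonic ?monicXsubC // size_XsubC addn2.
  by rewrite size_map_poly => sz; move: sz_p; rewrite sz ltnS => /gtn_eqF ->.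
(* By separability [e0 x] is a simple root, so the root [b] of the cofactor [r] is a different
   one. *)
have [_ rx] : separable_poly r /\ ~~ root r (e0 x).
  by apply/andP; rewrite -separable_root -er separable_map.
have pb : root (map_poly tau p) b by rewrite er rootM rb.
have [M [i [f [g [fi gi [z fz gz]]]]]] := simple_embedding p0 px pmin pb.
have [||e eE] := @embedding_extends F Omega s M f g.
- exact: algebraic_ext_over fi (separable_ext_algebraic sep).
- move=> S sS fS sS'; apply: gen => //.
  by move=> _ [c _ <-]; apply: fS; exists (i c).
exists e => [c|]; first by rewrite -[in LHS]fi eE gi.
by rewrite -[in X in X != _]fz eE gz; apply: contraNneq rx => <-.
Qed.

Lemma generates_comp (E M F : fieldType) (i : {rmorphism E -> M}) (f : {rmorphism M -> F})
    (s : seq M) (r : seq F) :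
  generates i s -> generates f r -> generates (f \o i) (map f s ++ r).
Proof.
move=> gs gr S sS iS srS x; apply: gr => //; last first.
  by move=> y /= yr; apply: srS; rewrite /= mem_cat yr orbT.
move=> _ [y _ <-]; apply: (gs (f @^-1` S)).
- have [S1 SB SV] := sS; split=> /=; first by rewrite /preimage /= rmorph1.
    by move=> u v Su Sv; rewrite /preimage /= rmorphB; exact: SB.
  by move=> u v Su Sv; rewrite /preimage /= fmorph_div; exact: SV.
- by move=> _ [c _ <-]; apply: iS; exists c.
- by move=> z /= zs; apply: srS; rewrite /= mem_cat map_f.
Qed.

Lemma ext_degree_generates (E F : fieldType) (iota : {rmorphism E -> F}) d :
  ext_degree iota d -> exists s, generates iota s.
Proof.
move=> [b bE]; exists [seq b k | k <- enum 'I_d] => S [S1 SB SV] iS bS x.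
have S0 : S 0 by rewrite -(subrr 1); exact: SB.
have SN u : S u -> S (- u) by move=> Su; rewrite -sub0r; exact: SB.
have SD u v : S u -> S v -> S (u + v).
  by move=> Su Sv; rewrite -[v]opprK; apply: SB => //; exact: SN.
have SI u : S u -> S u^-1 by move=> Su; rewrite -div1r; exact: SV.
have SM u v : S u -> S v -> S (u * v).
  by move=> Su Sv; rewrite -[v]invrK; apply: SV => //; exact: SI.
have [c [-> _]] := bE x; apply: (big_ind S) => // k _; apply: SM.
  by apply: iS; exists (c k).
by apply: bS; rewrite /= map_f // mem_enum.
Qed.

Lemma poly_roots_seq (F : fieldType) (p : {poly F}) : p != 0 ->
  exists s : seq F, forall x, root p x -> x \in s.
Proof.
elim/ltn_ind: {p}(size p) {-2}p (erefl (size p)) => n IH p sz p0.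
case: (pselect (exists x, root p x)) => [[x px]|no]; last first.
  by exists [::] => x px; case: no; exists x.
have [q eq] := factor_theorem _ _ px.
have q0 : q != 0 by apply: contra_neq p0 => q0; rewrite eq q0 mul0r.
have [|s sq] := IH (size q) _ q erefl q0.
  by rewrite -sz eq size_Mmonic ?monicXsubC // size_XsubC addn2.
exists (x :: s) => y; rewrite eq rootM root_XsubC inE orbC => /orP[->|/sq ->] //.
by rewrite orbT.
Qed.
End FieldEmbeddings.

(** * Automorphism groups of covers *)

Section Automorphisms.
Import GRing.Theory.
Local Open Scope classical_set_scope.
Local Open Scope ring_scope.
Variable K : fieldType.

Lemma Aut_subgroup (C D : curve K) (phi : mor C D) : subgroup (Aut phi).
Proof.
split; first exact: mor_comp1.
  move=> mu nu Amu Anu; rewrite /Aut /= mor_compA.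
  by rewrite (Amu : mor_comp phi mu = phi).
by move=> mu Amu; exact: (ainv_aut Amu).
Qed.

Lemma Aut_comp (C D E : curve K) (f : mor C D) (g : mor D E) :
  Aut f `<=` Aut (mor_comp g f).
Proof. by move=> mu Amu; rewrite /Aut /= -mor_compA (Amu : mor_comp f mu = f). Qed.

Lemma Aut_fixes (C D : curve K) (phi : mor C D) (mu : aut C) : Aut phi mu ->
  forall a, mcom mu (mcom phi a) = mcom phi a.
Proof. by move=> Amu a; have /(congr1 (fun k => mcom k a)) := Amu. Qed.

(** An automorphism is determined by the images of a basis, and these are all roots of one nonzero
    polynomial [P]. *)
Lemma finite_Aut (C D : curve K) (phi : mor C D) d :
  separable_ext (mcom phi) -> ext_degree (mcom phi) d -> finite_set (Aut phi).
Proof.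
move=> sep [b bE].
have /choice [p pE] : forall k, exists p : {poly funfield D},
    p != 0 /\ root (map_poly (mcom phi) p) (b k).
  by move=> k; have [p /separable_poly_neq0 p0 pk] := sep (b k); exists p.
pose P := \prod_k map_poly (mcom phi) (p k).
have [s sP] : exists s : seq (funfield C), forall x, root P x -> x \in s.
  by apply: poly_roots_seq; apply/prodf_neq0 => k _; rewrite map_poly_eq0 (pE k).1.
have conj_s mu k : Aut phi mu -> mcom mu (b k) \in s.
  move=> Amu; apply: sP; rewrite /P (bigD1 k) //= rootM; apply/orP; left.
  have -> : map_poly (mcom phi) (p k) = map_poly (mcom mu) (map_poly (mcom phi) (p k)).
    by rewrite -map_poly_comp; apply: eq_map_poly => c /=; rewrite Aut_fixes.
  by rewrite fmorph_root (pE k).2.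
have Aut_ext mu nu : Aut phi mu -> Aut phi nu ->
    (forall k, mcom mu (b k) = mcom nu (b k)) -> mu = nu.
  move=> Amu Anu e; apply: aut_ext; apply: mor_comorphism_inj => a.
  have [c [-> _]] := bE a; rewrite !rmorph_sum; apply: eq_bigr => k _.
  by rewrite !rmorphM /= !Aut_fixes // e.
(* [h] sends a table of positions in [s] to the automorphism of [phi] with those values on the
   basis, if there is one, so a finite set maps onto [Aut phi]. *)
have /choice [h hE] : forall g : {ffun 'I_d -> 'I_(size s)}, exists nu, forall mu, Aut phi mu ->
    (forall k, mcom mu (b k) = s`_(g k)) -> mu = nu.
  move=> g; case: (pselect (exists mu, Aut phi mu /\ forall k, mcom mu (b k) = s`_(g k))).
    move=> [nu [Anu nuE]]; exists nu => mu Amu muE.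
    by apply: Aut_ext => // k; rewrite muE nuE.
  by move=> no; exists (aut_id C) => mu Amu muE; case: no; exists mu.
apply: (@sub_finite_set _ _ (h @` setT)); last exact/finite_image/finite_finset.
move=> mu Amu; have lt_s k : (index (mcom mu (b k)) s < size s)%N by rewrite index_mem conj_s.
exists [ffun k => Ordinal (lt_s k)] => //; apply/esym/hE => // k.
by rewrite ffunE /= nth_index // conj_s.
Qed.

(* An automorphism and an element of the monodromy group act on embeddings by *)
(* composition on opposite sides, so they commute. With [g e0 = e0 mu], and   *)
(* [h] in the stabilizer of the block of embeddings that agree with [e0] on   *)
(* K(B), this gives [h e0 mu = h g e0 = g h^g e0], which agrees with [e0 mu]  *)
(* on K(B) because [h^g] is again in the stabilizer. Hence [e0 mu K(B)] is    *)
(* fixed by the whole block of [e0].                                          *)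
Lemma dedekind_aut_stable (C B D : curve K) (f : mor C B) (g : mor B D)
    (Omega : closedFieldType) (j : {rmorphism funfield D -> Omega})
    (G : set (permutation (embedding (mor_comp g f) j)))
    (s : seq (funfield C)) (r : seq (funfield C)) (mu : aut C) :
  separable_ext (mcom f) -> generates (mcom f) s ->
  algebraic_ext (mcom (mor_comp g f)) -> generates (mcom (mor_comp g f)) r ->
  G `<=` Mon (mor_comp g f) j -> transitive_perm G -> dedekind G ->
  Aut (mor_comp g f) mu ->
  forall x, exists y, mcom f y = mcom mu (mcom f x).
Proof.
move=> sep gens alg genr GMon Gtrans [[G1 GM GV] Gnormal] Amu x.
have [e0' e0E] := embedding_extends j alg genr.
pose e0 : embedding (mor_comp g f) j := exist _ e0' e0E.
apply: contrapT => /forallNP Nx.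
have [c|e1' e1E ne] := embedding_separates e0' sep gens (x := mcom mu (mcom f x)).
  by apply/eqP; exact: Nx.
have e1j a : e1' (mcom (mor_comp g f) a) = j a by rewrite /= e1E -e0E.
pose e0mu : {rmorphism funfield C -> Omega} := e0' \o mcom mu.
have emuj a : e0mu (mcom (mor_comp g f) a) = j a.
  by rewrite -[RHS]e0E -[in RHS](Aut_fixes Amu).
pose emu : embedding (mor_comp g f) j := exist _ e0mu emuj.
(* [h] sends [e0] to the separating embedding, which agrees with [e0] on K(B), so it stabilizes the
   block. The next element [k] sends [e0] to [e0 mu]; it is the group element written as g in the
   explanation of the lemma. *)
have [h Gh he] := Gtrans e0 (exist _ e1' e1j).
have [k Gk ke] := Gtrans e0 emu.
(* A single map [sigma] is applied to the values of all embeddings, so equal values stay equal even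
   at different arguments. Taken at [mu] of an element and at the element itself, this is the
   commutation with [mu]. *)
have act_agree u (e e' : embedding (mor_comp g f) j) a b : G u ->
    sval e a = sval e' b -> sval (u e) a = sval (u e') b.
  by move=> /GMon [sigma _ sE] eab; rewrite !sE eab.
pose H := [set u | G u /\ forall a, sval (u e0) (mcom f a) = sval e0 (mcom f a)].
have [_ _ Hnormal] : normal_subgroup H G.
  apply: Gnormal; last by move=> u [].
  split; first by split.
    move=> u v [Gu Hu] [Gv Hv]; split; first exact: GM.
    by move=> a /=; rewrite (act_agree u _ e0 _ (mcom f a)).
  move=> u [Gu Hu]; split; first exact: GV.
  move=> a; have Gu' := GV _ Gu.
  by rewrite -(act_agree _ _ _ _ _ Gu' (Hu a)) /= pfunK.
have Hh : H h by split=> // a; rewrite he /= e1E.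
have [_ Hhk] := Hnormal _ _ Gk Hh.
case/eqP: ne.
have -> : e1' (mcom mu (mcom f x)) = sval (h (k e0)) (mcom f x).
  rewrite -[e1']/(sval (exist _ e1' e1j : embedding (mor_comp g f) j)) -he.
  by apply: act_agree => //; rewrite ke.
have -> : h (k e0) = k ((h ^ k)%g e0) by exact: (esym (Defs.pinvK k (h (k e0)))).
by rewrite (act_agree k _ e0 _ _ Gk (Hhk x)) ke.
Qed.

(** As [f] can be cancelled on the right, [nu] is unique, and identities between descended
    automorphisms may be checked after composing with [f]. *)
Lemma descended_automorphisms (C B D : curve K) (f : mor C B) (g : mor B D) :
  (forall mu, Aut (mor_comp g f) mu -> exists nu : aut B, mor_comp f mu = mor_comp nu f) ->
  normal_subgroup (Aut f) (Aut (mor_comp g f)) /\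
  quotient_iso_subgroup (Aut (mor_comp g f)) (Aut f) (Aut g).
Proof.
move=> desc.
have /choice [r rE] : forall mu, exists nu : aut B, Aut (mor_comp g f) mu ->
    mor_comp f mu = mor_comp nu f.
  move=> mu; case: (pselect (Aut (mor_comp g f) mu)) => [/desc [nu e]|no].
    by exists nu.
  by exists (aut_id B).
have sA := Aut_subgroup (mor_comp g f); have [_ AM _] := sA.
have sBA := Aut_comp (f := f) g.
have epi (mu nu : aut B) : mor_comp mu f = mor_comp nu f -> mu = nu.
  by move=> /mor_comp_epi; exact: aut_ext.
have rM (x y : aut C) : Aut (mor_comp g f) x -> Aut (mor_comp g f) y ->
    r (x * y)%g = (r x * r y)%g.
  move=> Ax Ay; apply: epi; rewrite -rE; last exact: AM.
  by rewrite /= mor_compA rE // -mor_compA rE // mor_compA.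
have rD x : Aut (mor_comp g f) x -> Aut g (r x).
  by move=> Ax; apply: (@mor_comp_epi _ _ _ _ f); rewrite -mor_compA -rE // mor_compA Ax.
have kerr x : Aut (mor_comp g f) x -> Aut f x <-> r x = 1%g.
  move=> Ax; split=> [Afx|r1].
    by apply: epi; rewrite -rE // mor_1comp; exact: Afx.
  by rewrite /Aut /= rE // r1 mor_1comp.
split; first exact: (kernel_normal sA sBA rM kerr).
exact: (quotient_iso_image sA sBA rM rD kerr).
Qed.

Lemma psi_factor (C : nat -> curve K) (phi_ : forall i, mor (C i) (C i.+1)) i n :
  (i <= n)%N -> exists g : mor (C i) (C n), psi phi_ n = mor_comp g (psi phi_ i).
Proof.
elim: n => [|n IH]; first by rewrite leqn0 => /eqP ->; exists (mor_id _); rewrite mor_1comp.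
rewrite leq_eqVlt => /orP[/eqP ->|]; first by exists (mor_id _); rewrite mor_1comp.
by rewrite ltnS => /IH [g e]; exists (mor_comp (phi_ n) g); rewrite /= e mor_compA.
Qed.

Lemma psi_generates (C : nat -> curve K) (phi_ : forall i, mor (C i) (C i.+1)) n :
  (forall i, (i < n)%N -> exists s, generates (mcom (phi_ i)) s) ->
  exists s, generates (mcom (psi phi_ n)) s.
Proof.
elim: n => [|n IH] gen; first by exists [::] => S _ iS _ x; apply: iS; exists x.
have [|s gs] := IH; first by move=> i lt_in; apply: gen; exact: ltnW.
have [r gr] := gen n (ltnSn n).
by eexists; exact: (generates_comp gr gs).
Qed.

Lemma separable_ext_over (C B D : curve K) (f : mor C B) (g : mor B D) :
  separable_ext (mcom (mor_comp g f)) -> separable_ext (mcom f).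
Proof.
move=> sep a; have [p psep pa] := sep a; exists (map_poly (mcom g) p).
  by rewrite separable_map.
by rewrite -map_poly_comp.
Qed.
End Automorphisms.

(** * Assembly along the decomposition *)

Theorem theorem7p1 (K : fieldType) (n : nat) (C : nat -> curve K)
    (phi_ : forall i, mor (C i) (C i.+1)) (phi : mor (C 0) (C n))
    (phi_cover : is_cover phi)
    (Omega : closedFieldType) (j : {rmorphism funfield (C n) -> Omega})
    (Omega_closure : is_algebraic_closure j)
    (Mon_dedekind : exists G : set (permutation (embedding phi j)),
       [/\ subgroup G, subset G (Mon phi j), transitive_perm G & dedekind G])
    (phi_decomposition : is_decomposition phi_ phi) :
  (forall i, 1 <= i < n ->
     normal_subgroup (Aut (psi phi_ i)) (Aut (psi phi_ i.+1)) /\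
     quotient_iso_subgroup (Aut (psi phi_ i.+1)) (Aut (psi phi_ i))
       (Aut (phi_ i))) /\
  [/\ finite_set (Aut phi),
      forall i, i < n -> finite_set (Aut (phi_ i)) &
      set_order (Aut phi) %| \prod_(0 <= i < n) set_order (Aut (phi_ i))].
Proof.
have [_ decomp phiE] := phi_decomposition; subst phi.
have [G [_ GMon Gtrans Gded]] := Mon_dedekind.
have gen i : i <= n -> exists s, generates (mcom (psi phi_ i)) s.
  move=> le_in; apply: psi_generates => k lt_ki.
  by have [_ [d _ /ext_degree_generates]] := decomp k (leq_trans lt_ki le_in).
have step i : i < n ->
    normal_subgroup (Aut (psi phi_ i)) (Aut (psi phi_ i.+1)) /\
    quotient_iso_subgroup (Aut (psi phi_ i.+1)) (Aut (psi phi_ i)) (Aut (phi_ i)).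
  move=> lt_in; apply: descended_automorphisms => mu.
  have [s gens] := gen i (ltnW lt_in); have [r genr] := gen n (leqnn n).
  have [h hE] := psi_factor phi_ lt_in.
  have [g gE] := psi_factor phi_ (ltnW lt_in).
  (* Automorphisms of a partial composite are automorphisms of the whole cover, so the same group
     [G] serves at every level. *)
  move=> Amu; have {}Amu : Aut (psi phi_ n) mu by rewrite hE; exact: Aut_comp.
  have Amu' : Aut (psi phi_ n) (aut_inv mu) by have [_ _] := Aut_subgroup (psi phi_ n); apply.
  have alg := separable_ext_algebraic phi_cover.
  (* The type of [G] mentions [psi phi_ n], so all that depends on it is generalized before it is
     rewritten as [g] after [psi phi_ i]. *)
  move: G GMon Gtrans Gded phi_cover genr alg Amu Amu'; clear -gens gE.
  rewrite gE => G GMon Gtrans Gded sep genr alg Amu Amu'.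
  have sepi := separable_ext_over sep.
  apply: aut_descends => x.
    exact: (dedekind_aut_stable sepi gens alg genr GMon Gtrans Gded Amu).
  exact: (dedekind_aut_stable sepi gens alg genr GMon Gtrans Gded Amu').
have fin i : i < n -> finite_set (Aut (phi_ i)).
  by move=> /decomp [sep [d _ deg]]; exact: finite_Aut deg.
split; first by move=> i /andP[_ /step].
suff : forall k, k <= n -> finite_set (Aut (psi phi_ k)) /\
    set_order (Aut (psi phi_ k)) %| \prod_(0 <= i < k) set_order (Aut (phi_ i)).
  by move=> /(_ n (leqnn n)) [finn dvdn]; split.
elim=> [_|k IH lt_kn].
  have -> : Aut (psi phi_ 0) = [set aut_id (C 0)]%classic.
    apply/seteqP; split=> mu /= Amu; last by rewrite Amu; exact: mor_comp1.
    by apply: aut_ext; move: Amu; rewrite /Aut /= mor_1comp.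
  split; first exact: finite_set1.
  by rewrite /set_order fset_set1 cardfs1.
have [fink dvdk] := IH (ltnW lt_kn); have [nk qk] := step k lt_kn.
have [finS dvdS] := quotient_iso_finite (Aut_subgroup _) nk (Aut_subgroup _) qk fink (fin k lt_kn).
split=> //; rewrite big_nat_recr //=.
by apply: dvdn_trans dvdS _; exact: dvdn_mul.
Qed.
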